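(* Let $\mathcal H$ be a Hilbert space, let $0<m\le M$ be scalars, and let $A,B$ be positive definite bounded linear operators on $\mathcal H$ such that $m\le A,B\le M$. Let $0\le t\le 1$. Then for any unit vector $x\in\mathcal H$, \[\left\langle (A\natural_t B)x,x\right\rangle\le \frac{\left(M^{1+t}+m^{1+t}\right)^2}{4M^{1+t}m^{1+t}}\left\langle Ax,x\right\rangle^{1-t}\left\langle Bx,x\right\rangle^{t}.\]
   Context: For a bounded operator $A$ on $\mathcal H$, $A\ge 0$ means $\langle Ax,x\rangle\ge 0$ for all $x\in\mathcal H$; $A$ is positive definite if $A\ge0$ and $A$ is invertible. $A\ge B$ means $A-B\ge 0$, and for real scalars $m\le A\le M$ means $mI\le A\le MI$; ''$m\le A,B\le M$'' means both $m\le A\le M$ and $m\le B\le M$. For positive definite $A,B$, the geometric mean is $A\sharp B=A^{1/2}(A^{-1/2}BA^{-1/2})^{1/2}A^{1/2}$, and for $0\le t\le1$ the weighted spectral geometric mean is $A\natural_t B=(A^{-1}\sharp B)^{t}A(A^{-1}\sharp B)^{t}$. *)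

(* Defs.v *)
From HB Require Import structures.
From mathcomp Require Import all_boot all_order all_algebra sesquilinear.
From mathcomp Require Import all_classical all_reals all_analysis.
From mathcomp Require Export complex.

Set Implicit Arguments.
Unset Strict Implicit.
Unset Printing Implicit Defensive.

Import Order.TTheory GRing.Theory Num.Theory.
Import numFieldNormedType.Exports.

Local Open Scope classical_set_scope.
Local Open Scope ring_scope.
Local Open Scope complex_scope.

(* A complex Hilbert space is given by a complete normed space H over R[i] and
   an inner product ip (linear in its first argument) inducing its norm. *)
Definition inner_product_of (R : realType) (H : completeNormedModType R[i])
    (ip : {dot H for @Num.conj R[i]}) : Prop :=
  forall x : H, `|x| ^+ 2 = ip x x.

Section BoundedOperators.
Variables (R : realType) (H : completeNormedModType R[i]).
Implicit Types A B : H -> H.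

Definition bounded_operator A : Prop :=
  linear A /\ bounded_near A (nbhs (0 : H)).

Definition is_inverse A B : Prop :=
  [/\ bounded_operator B, A \o B = id & B \o A = id].

Definition op_invertible A : Prop := exists B, is_inverse A B.

Definition op_inv A : H -> H := xget (fun=> 0) [set B | is_inverse A B].

Definition spectrum A : set R[i] :=
  [set z | ~ op_invertible (fun x => A x - z *: x)].

Definition op_horner (p : {poly R}) A : H -> H :=
  fun x => \sum_(i < size p) (p`_i)%:C *: iter i A x.

Definition op_norm_cvg (An : nat -> H -> H) A : Prop :=
  forall e : R, 0 < e ->
    \forall n \near \oo, forall x, `|An n x - A x| <= e%:C * `|x|.

(* Continuous functional calculus of an operator with real spectrum: f(A) is
   the operator-norm limit of p_n(A), for real polynomials p_n converging to f
   uniformly on the spectrum of A. *)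
Definition is_op_fun (f : R -> R) A B : Prop :=
  bounded_operator B /\
  exists p : nat -> {poly R},
    {uniform [set r : R | spectrum A r%:C],
       (fun n r => (p n).[r]) @ \oo --> f} /\
    op_norm_cvg (fun n => op_horner (p n) A) B.

Definition op_fun (f : R -> R) A : H -> H :=
  xget (fun=> 0) [set B | is_op_fun f A B].

Definition op_pow A (s : R) : H -> H := op_fun (fun r => r `^ s) A.

Definition geometric_mean A B : H -> H :=
  op_pow A 2^-1
    \o op_pow (op_pow A (- 2^-1) \o B \o op_pow A (- 2^-1)) 2^-1
    \o op_pow A 2^-1.

Definition spectral_geometric_mean (t : R) A B : H -> H :=
  op_pow (geometric_mean (op_inv A) B) t
    \o A
    \o op_pow (geometric_mean (op_inv A) B) t.

Variable ip : {dot H for @Num.conj R[i]}.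

(* The order of R[i] makes 0 <= z mean that z is real and nonnegative. *)
Definition op_ge0 A : Prop := forall x, 0 <= ip (A x) x.

Definition op_le A B : Prop := op_ge0 (fun x => B x - A x).

Definition positive_definite A : Prop :=
  [/\ bounded_operator A, op_ge0 A & op_invertible A].

Definition scalar_op (a : R) : H -> H := fun x => a%:C *: x.

End BoundedOperators.

(* Main.v *)
(* Write G = A^{-1} # B and T = G^t, so that G A G = B.  Since m <= A, B <= M,
   this Riccati equation gives (m/M)^{1/2} <= G <= (M/m)^{1/2}, hence
   a A^{-1} <= T <= b A^{-1} with a = m (m/M)^{t/2} and b = M (M/m)^{t/2}.
   Positivity of (W - a)(b - W) for W = A^{1/2} T A^{1/2} reads
     <TATx,x> + a b <A^{-1}x,x> <= (a + b) <Tx,x>,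
   so <TATx,x> <A^{-1}x,x> <= K <Tx,x>^2 with K the constant of the theorem.
   The right side is controlled by <Tx,x> <= <Gx,x>^t (McCarthy) and
   <Gx,x>^2 <= <Bx,x> <A^{-1}x,x> (Cauchy-Schwarz for the form of A), and
   1 <= <Ax,x> <A^{-1}x,x> turns the remaining power of <A^{-1}x,x> into
   <Ax,x>^{1-t}.

   Powers of operators are limits of polynomials converging uniformly on the
   spectrum only, so everything about them rests on one fact: for self-adjoint A
   and a real polynomial p there is a spectral point r with p(A) <= p(r). *)

Require Import Defs.
From HB Require Import structures.
From mathcomp Require Import all_boot all_order all_algebra sesquilinear.
From mathcomp Require Import all_classical all_reals all_analysis.
From mathcomp Require Import complex ring lra.

Set Implicit Arguments.
Unset Strict Implicit.
Unset Printing Implicit Defensive.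

Import Order.TTheory GRing.Theory Num.Theory.
Import numFieldNormedType.Exports.

Local Open Scope classical_set_scope.
Local Open Scope ring_scope.
Local Open Scope complex_scope.

(** * Linear maps and the real part of the inner product *)

Section LinearFunctions.
Variables (K : nzRingType) (U V : lmodType K) (f : U -> V).
Hypothesis lf : linear f.

Lemma linfunD u v : f (u + v) = f u + f v.
Proof. by have := lf 1 u v; rewrite !scale1r. Qed.

Lemma linfun0 : f 0 = 0.
Proof. by apply: (addrI (f 0)); rewrite -linfunD !addr0. Qed.

Lemma linfunZ a u : f (a *: u) = a *: f u.
Proof. by have := lf a u 0; rewrite linfun0 !addr0. Qed.

Lemma linfunB u v : f (u - v) = f u - f v.
Proof. by rewrite -scaleN1r linfunD linfunZ scaleN1r. Qed.

Lemma linfun_sum (I : Type) (r : seq I) (g : I -> U) :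
  f (\sum_(i <- r) g i) = \sum_(i <- r) f (g i).
Proof.
by elim: r => [|i r IH]; rewrite ?big_nil ?linfun0 // !big_cons linfunD IH.
Qed.

End LinearFunctions.

Section RealInnerProduct.
Variables (R : realType) (H : completeNormedModType R[i]).
Variable ip : {dot H for @Num.conj R[i]}.
Local Notation "''[' u , v ]" := (complex.Re (ip u v)).
Local Notation "''[' u ]" := '[u, u].
Implicit Types (x y z : H) (A B : H -> H).

Lemma dotC x y : ip x y = (ip y x)^*.
Proof. by rewrite hermC expr0 mul1r. Qed.

Lemma dotZr (a : R[i]) x y : ip x (a *: y) = conjc a * ip x y.
Proof. by rewrite linearZr_LR. Qed.

Lemma dotZr_real (a : R) x y : ip x (a%:C *: y) = a%:C * ip x y.
Proof. by rewrite dotZr conjc_real. Qed.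

Lemma ripC x y : '[x, y] = '[y, x].
Proof. by rewrite dotC; case: (ip y x). Qed.

Lemma ripDl x y z : '[x + y, z] = '[x, z] + '[y, z].
Proof. by rewrite linearDl raddfD. Qed.

Lemma ripDr x y z : '[z, x + y] = '[z, x] + '[z, y].
Proof. by rewrite ripC ripDl !(ripC z). Qed.

Lemma ripNl x z : '[- x, z] = - '[x, z].
Proof. by rewrite linearNl raddfN. Qed.

Lemma ripNr x z : '[z, - x] = - '[z, x].
Proof. by rewrite ripC ripNl ripC. Qed.

Lemma ripZl (a : R) x z : '[a%:C *: x, z] = a * '[x, z].
Proof.
by rewrite linearZl_LR /=; case: (ip x z) => u v /=; rewrite mul0r subr0.
Qed.

Lemma ripZr (a : R) x z : '[z, a%:C *: x] = a * '[z, x].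
Proof. by rewrite ripC ripZl ripC. Qed.

(** Conjugate linearity turns the imaginary part into a value of the real form, so real identities
    can recover the complex form. *)
Lemma rip_ir x y : '[x, 'i%C *: y] = complex.Im (ip x y).
Proof. by rewrite dotZr; case: (ip x y) => e f /=; ring. Qed.

Lemma rip0l x : '[0, x] = 0.
Proof. by rewrite linear0l. Qed.

Definition ripE := (ripDl, ripDr, ripNl, ripNr, ripZl, ripZr).

Hypothesis hip : inner_product_of ip.

Lemma dotxx x : ip x x = ('[x])%:C.
Proof.
by rewrite -hip RRe_real // realX // ger0_real.
Qed.

Lemma rip_ge0 x : 0 <= '[x].
Proof. by rewrite -lecR -dotxx -hip exprn_ge0. Qed.

Definition symmetric_op A := forall x y, ip (A x) y = ip x (A y).

Lemma symmetric_rip A x y : symmetric_op A -> '[A x, y] = '[x, A y].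
Proof. by move=> ->. Qed.

(* Over the complex field, polarization recovers all of [ip (A x) y] from the
   values [ip (A z) z]. *)
Lemma real_form_symmetric A : linear A ->
  (forall x, ip (A x) x \is Num.real) -> symmetric_op A.
Proof.
move=> lA rA.
have rA' x : ip (A x) x = ip x (A x).
  by rewrite (dotC x) -(RRe_real (rA x)) conjc_real.
(* The defect [s y x] is minus the conjugate of [s x y]. Reality at [x + y] kills the imaginary part
   of [s x y]; replacing [y] by [i y] then kills its real part. *)
pose s x y := ip (A x) y - ip x (A y).
have s_real x y : complex.Im (s x y) = 0.
  have := rA' (x + y); rewrite (linfunD lA) !linearDl !linearDr /= !rA' /s.
  rewrite (dotC y (A x)) (dotC (A y) x).
  case: (ip (A x) y) (ip x (A y)) => [a b] [c d].
  case: (ip x (A x)) (ip y (A y)) => [e f] [g h] [_] /= E.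
  lra.
move=> x y; apply/eqP; rewrite -subr_eq0 -/(s x y) eq_complex /= s_real eqxx.
rewrite andbT; have := s_real x ('i%C *: y).
rewrite /s (linfunZ lA) !dotZr -mulrBr -/(s x y) /=.
case: (s x y) => a b /=; rewrite !(mul0r, add0r, mulN1r) => ?; apply/eqP; lra.
Qed.

(** The norm of [H] takes values in [R[i]]; a copy in [R] keeps the estimates in a totally ordered
    field. *)
Definition rnorm x : R := Num.sqrt '[x].

Lemma normE x : `|x| = (rnorm x)%:C.
Proof.
apply/eqP; rewrite -(eqrXn2 (n := 2)) // ?ler0c ?sqrtr_ge0 //.
by rewrite hip dotxx -rmorphXn /= sqr_sqrtr ?rip_ge0.
Qed.

Lemma rnorm_ge0 x : 0 <= rnorm x.
Proof. exact: sqrtr_ge0. Qed.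

Lemma rnorm_sqr x : rnorm x ^+ 2 = '[x].
Proof. by rewrite sqr_sqrtr ?rip_ge0. Qed.

Lemma rnormD x y : rnorm (x + y) <= rnorm x + rnorm y.
Proof. by rewrite -lecR rmorphD /= -!normE ler_normD. Qed.

Lemma rnormBC x y : rnorm (x - y) = rnorm (y - x).
Proof. by apply: complexI; rewrite -!normE distrC. Qed.

Lemma rnorm0 : rnorm 0 = 0.
Proof. by apply: complexI; rewrite -normE normr0. Qed.

Lemma rnorm_eq0 x : rnorm x = 0 -> x = 0.
Proof. by move=> x0; apply/normr0_eq0; rewrite normE x0. Qed.

Lemma rip_eq0 x : '[x] = 0 -> x = 0.
Proof. by move=> x0; apply: rnorm_eq0; rewrite /rnorm x0 sqrtr0. Qed.

Lemma ler_rnorm (k : R) x y : 0 <= k ->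
  (rnorm x <= k * rnorm y) = ('[x] <= k ^+ 2 * '[y]).
Proof.
move=> k0; rewrite -[LHS](ler_pXn2r (n := 2)) ?nnegrE ?mulr_ge0 ?rnorm_ge0 //.
by rewrite exprMn !rnorm_sqr.
Qed.

Lemma ler_Mrnorm (k : R) x y : 0 <= k ->
  (k * rnorm y <= rnorm x) = (k ^+ 2 * '[y] <= '[x]).
Proof.
move=> k0; rewrite -[LHS](ler_pXn2r (n := 2)) ?nnegrE ?mulr_ge0 ?rnorm_ge0 //.
by rewrite exprMn !rnorm_sqr.
Qed.

(** Completeness of [H] with real tolerances: a positive element of [R[i]] is real. *)
Lemma cauchy_rnorm_cvg (u : nat -> H) :
  (forall e, 0 < e -> exists N, forall n m, (N <= n)%N -> (N <= m)%N ->
    rnorm (u n - u m) <= e) ->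
  exists l, forall e, 0 < e -> exists N, forall n, (N <= n)%N ->
    rnorm (u n - l) <= e.
Proof.
move=> cu.
have : cauchy (u @ \oo).
  apply/cauchy_exP => e e0; have eE : e = (complex.Re e)%:C.
    by rewrite RRe_real // gtr0_real.
  have e0' : 0 < complex.Re e / 2 by rewrite divr_gt0 // -ltcR -eE.
  have [N uN] := cu _ e0'; exists (u N); exists N => // n /= Nn.
  rewrite -ball_normE /= normE eE ltcR; apply: le_lt_trans (uN _ _ (leqnn N) Nn) _.
  by rewrite ltr_pdivrMr // mulr_natr mulr2n ltrDl -ltcR -eE.
move/cauchy_cvgP => /cvg_ex[l ul]; exists l => e e0.
have /cvgrPdist_le /(_ e%:C) := ul.
rewrite ltcR => /(_ e0) [N _ uN]; exists N => n Nn.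
by rewrite -lecR -normE distrC; exact: uN.
Qed.

End RealInnerProduct.

(** * Self-adjoint operators *)

Section SelfAdjoint.
Variables (R : realType) (H : completeNormedModType R[i]).
Variable ip : {dot H for @Num.conj R[i]}.
Hypothesis hip : inner_product_of ip.
Local Notation "''[' u , v ]" := (complex.Re (ip u v)).
Local Notation "''[' u ]" := '[u, u].
Local Notation nr := (rnorm ip).
Local Notation symm := (symmetric_op ip).
Implicit Types (x y z : H) (A B S : H -> H).

(** Evaluate at the minimiser [- b / c]. For [c = 0] the polynomial is affine, and a nonconstant one
    takes the value -1. *)
Lemma discriminant_le (a b c : R) : 0 <= c ->
  (forall s, 0 <= a + 2 * s * b + s ^+ 2 * c) -> b ^+ 2 <= a * c.
Proof.
rewrite le0r => /predU1P[->|c0] P.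
  suff -> : b = 0 by rewrite expr0n mulr0.
  apply/eqP/negPn/negP => b0; have := P (- (a + 1) / (2 * b)).
  have -> : a + 2 * (- (a + 1) / (2 * b)) * b + (- (a + 1) / (2 * b)) ^+ 2 * 0
    = -1 by field.
  lra.
have := P (- b / c); have c0' : c != 0 by rewrite gt_eqF.
have -> : a + 2 * (- b / c) * b + (- b / c) ^+ 2 * c = (a * c - b ^+ 2) / c.
  by field.
by rewrite pmulr_lge0 ?invr_gt0 // subr_ge0.
Qed.

(** The form is nonnegative at [x + s y] for every real [s], so its discriminant has a sign. *)
Lemma psd_cauchy_schwarz A x y : linear A -> symm A ->
  (forall z, 0 <= '[A z, z]) -> '[A x, y] ^+ 2 <= '[A x, x] * '[A y, y].
Proof.
move=> lA sA pA; apply: discriminant_le => // s.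
suff <- : '[A (x + s%:C *: y), x + s%:C *: y] =
  '[A x, x] + 2 * s * '[A x, y] + s ^+ 2 * '[A y, y] by [].
rewrite (linfunD lA) (linfunZ lA) !ripE (symmetric_rip y x sA) (ripC ip y).
ring.
Qed.

Lemma rip_cauchy_schwarz x y : '[x, y] ^+ 2 <= '[x] * '[y].
Proof.
apply: (@psd_cauchy_schwarz id) => // z; exact: rip_ge0.
Qed.

(** Reads [c <= A <= d] on the real quadratic form; boundedness follows in [selfadjoint_bounded]. *)
Definition selfadjoint_in A (c d : R) := [/\ linear A, symm A &
  forall x, c * '[x] <= '[A x, x] <= d * '[x]].

Lemma selfadjoint_inW A c d c' d' : c' <= c -> d <= d' ->
  selfadjoint_in A c d -> selfadjoint_in A c' d'.
Proof.
move=> cc dd [lA sA bA]; split=> // x; have /andP[b1 b2] := bA x.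
by rewrite (le_trans _ b1) ?(le_trans b2) // ler_wpM2r // rip_ge0.
Qed.

(** Cauchy-Schwarz for the form of [S] at [x] and [S x], followed by [S <= d] at [S x]; one factor
    ['[S x]] cancels. *)
Lemma psd_sqr_le S d x : 0 <= d -> selfadjoint_in S 0 d ->
  '[S x] <= d * '[S x, x].
Proof.
move=> d0 [lS sS bS].
have pS z : 0 <= '[S z, z] by have /andP[+ _] := bS z; rewrite mul0r.
have := psd_cauchy_schwarz x (S x) lS sS pS.
have /andP[_ bx] := bS (S x); have := rip_ge0 hip (S x); have := pS x.
have [->|n0] := eqVneq '[S x] 0; first by move=> *; rewrite mulr_ge0.
move=> p0 p1 p2; rewrite -(ler_pM2r (x := '[S x])); last by rewrite lt_def n0.
rewrite -expr2; apply: le_trans p2 _.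
by rewrite -mulrA mulrCA ler_wpM2l.
Qed.

(** The numerical radius bounds the norm: polarize ['[A x, y]], use the parallelogram law, and take
    [y = A x / k]. *)
Lemma selfadjoint_rnorm A k x : 0 < k -> selfadjoint_in A (- k) k ->
  nr (A x) <= k * nr x.
Proof.
move=> k0 [lA sA bA]; rewrite ler_rnorm ?(ltW k0) //.
have P y : 2 * '[A x, y] <= k * ('[x] + '[y]).
  have /andP[_] := bA (x + y); have /andP[+ _] := bA (x - y).
  rewrite (linfunB lA) (linfunD lA) !ripE (symmetric_rip y x sA).
  rewrite (ripC ip y x) (ripC ip y (A x)); lra.
have := P ((k^-1)%:C *: A x); rewrite !ripE.
have kN : k != 0 by rewrite gt_eqF.
set u := '[x]; set v := '[A x] => E1; suff : k^-1 * v <= k * u.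
  by rewrite ler_pdivrMl // mulrA expr2.
have E3 : k * (k^-1 * (k^-1 * v)) = k^-1 * v by rewrite mulVKf.
move: E1; rewrite mulrDr E3; lra.
Qed.

Lemma rnorm_bounded_operator A k : linear A -> (forall x, nr (A x) <= k * nr x) ->
  bounded_operator A.
Proof.
move=> lA kA; split=> //; apply/ex_bound; exists `|k|%:C.
apply/nbhs_norm0P; exists 1 => //= x /=; rewrite (normE hip) => x1.
rewrite (normE hip) lecR; apply: le_trans (kA x) _.
have := x1; rewrite ltcR => {}x1.
apply: le_trans (ler_norm _) _; rewrite normrM ler_piMr //.
by rewrite ger0_norm ?rnorm_ge0 // ltW.
Qed.

Lemma selfadjoint_bounded A c d : selfadjoint_in A c d -> bounded_operator A.
Proof.
move=> sA; have [lA _ _] := sA.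
apply: (@rnorm_bounded_operator _ (`|c| + `|d| + 1)) => // x.
have : 0 <= `|c| by []. have : 0 <= `|d| by [].
have := ler_norm d; have := lerNnormlW (lexx `|c|) => h1 h2 h3 h4.
apply: selfadjoint_rnorm; first lra.
by apply: selfadjoint_inW sA; lra.
Qed.

(* Solves [A y = x] by iterating the contraction [y |-> S y + x / k], where
   [S = 1 - A / k]. *)
Lemma selfadjoint_pos_surj A c d x : 0 < c -> selfadjoint_in A c d ->
  exists y, A y = x.
Proof.
move=> c0 sA; have [lA symA bA] := sA.
(* This [k] dominates both [c] and [d], so [A / k] lies between [c / k] and 1, and [S] between 0 and
   [1 - c / k]. *)
pose k := `|d| + c; have k0 : 0 < k by rewrite ltr_wpDl.
have kN : k != 0 by rewrite gt_eqF.
(* Halving [c / k] keeps [q] positive even when [c = k], as [selfadjoint_rnorm] demands. *)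
pose q := 1 - c / (2 * k); have q1 : q < 1.
  by rewrite ltrBlDr ltrDl divr_gt0 // mulr_gt0.
have ck : c / k <= 1 by rewrite ler_pdivrMr // mul1r lerDr.
have qE : q = 1 - (c / k) / 2 by rewrite /q; field.
have q0 : 0 < q by rewrite qE; lra.
pose S y := y - (k^-1)%:C *: A y; pose b := (k^-1)%:C *: x.
have sS : selfadjoint_in S (- q) q.
  have lS : linear S.
    move=> a u v; rewrite /S lA scalerBr scalerDr !scalerA (mulrC a) opprD.
    by rewrite addrACA.
  split=> // [y z|y].
    by rewrite /S linearBl linearZl_LR linearBr /= symA dotZr_real.
  have /andP[b1 b2] := bA y; rewrite /S !ripE; have u0 := rip_ge0 hip y.
  have bk1 : c / k * '[y] <= k^-1 * '[A y, y].
    by rewrite mulrAC mulrC ler_pM2l ?invr_gt0.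
  have bk2 : k^-1 * '[A y, y] <= '[y].
    rewrite ler_pdivrMl //; apply: le_trans b2 _; rewrite ler_wpM2r //.
    by rewrite (le_trans (ler_norm d)) // lerDl ltW.
  have ck0 : 0 < c / k by rewrite divr_gt0.
  by rewrite qE; apply/andP; split; nra.
have [lS _ _] := sS.
have nS y : nr (S y) <= q * nr y by exact: selfadjoint_rnorm.
pose f y := S y + b; pose u n := iter n f 0.
(* The radius with [q * r + nr b = r]: the iteration never leaves this ball. *)
pose r := nr b / (1 - q).
have r0 : 0 <= r by rewrite divr_ge0 ?rnorm_ge0 // subr_ge0 ltW.
have ur n : nr (u n) <= r.
  elim: n => [|n IH]; first by rewrite /u /= rnorm0.
  apply: le_trans (rnormD hip _ _) _; apply: le_trans (lerD (nS _) (lexx _)) _.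
  have -> : nr b = (1 - q) * r by rewrite mulrC divfK // subr_eq0 gt_eqF.
  have : q * nr (u n) <= q * r by rewrite ler_wpM2l // ltW.
  rewrite /u /=; lra.
have fB y z : f y - f z = S (y - z).
  by rewrite /f opprD addrACA subrr addr0 -(linfunB lS).
have uD n m : nr (u (n + m)%N - u n) <= r * q ^+ n.
  elim: n => [|n IH]; first by rewrite expr0 mulr1 subr0.
  rewrite addSn [u _]/= [u n.+1]/= fB; apply: le_trans (nS _) _.
  by rewrite exprS mulrCA ler_wpM2l // ltW.
have small e : 0 < e -> exists N, r * q ^+ N <= e.
  move=> e0; have qa : `|q| < 1 by rewrite ger0_norm // ltW.
  have /cvgrPdist_le /(_ e e0) [N _ /(_ N (leqnn N))] := cvg_geometric r qa.
  rewrite /= sub0r normrN ger0_norm; first by exists N.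
  by rewrite mulr_ge0 // exprn_ge0 // ltW.
have [|l ul] := @cauchy_rnorm_cvg _ _ ip hip u.
  move=> e e0; have e20 : 0 < e / 2 by rewrite divr_gt0.
  have [N Ne] := small _ e20.
  exists N => n m /subnKC <- /subnKC <-.
  rewrite -(subrKA (u N)); apply: le_trans (rnormD hip _ _) _.
  rewrite [X in _ + X](rnormBC hip).
  have := uD N (n - N)%N; have := uD N (m - N)%N; lra.
have fl : f l = l.
  apply/eqP; rewrite -subr_eq0; apply/eqP/(rnorm_eq0 hip)/eqP.
  rewrite eq_le rnorm_ge0 andbT; apply/ler_addgt0Pl => e e0; rewrite addr0.
  have e20 : 0 < e / 2 by rewrite divr_gt0.
  have [N uN] := ul _ e20; have := uN _ (leqnn N); have := uN _ (leqnSn N).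
  rewrite -(subrKA (u N.+1)) [u N.+1]/= fB => h1 h2.
  apply: le_trans (rnormD hip _ _) _; have := nS (l - u N).
  rewrite (rnormBC hip l).
  have : q * nr (u N - l) <= 1 * (e / 2) by rewrite ler_pM ?rnorm_ge0 // ltW.
  lra.
exists l; have : (k^-1)%:C *: (x - A l) = 0.
  by apply: (addrI l); rewrite addr0 -[RHS]fl /f /S /b scalerBr addrA addrAC.
move/eqP; rewrite scaler_eq0 => /orP[/eqP/complexI/eqP|].
  by rewrite invr_eq0 (negbTE kN).
by rewrite subr_eq0 => /eqP.
Qed.


(** By Cauchy-Schwarz [c * nr y <= nr (A y)], which gives injectivity and the bound [c^-1] on the
    inverse; surjectivity is already known. *)
Lemma selfadjoint_pos_invertible A c d : 0 < c -> selfadjoint_in A c d ->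
  op_invertible A.
Proof.
move=> c0 sA; have [lA _ bA] := sA.
have lb y : c ^+ 2 * '[y] <= '[A y].
  have := rip_cauchy_schwarz (A y) y; have /andP[+ _] := bA y.
  have := rip_ge0 hip y; have := rip_ge0 hip (A y).
  set p := '[A y, y]; set q := '[A y]; set u := '[y].
  move=> q0; rewrite le0r => /predU1P[->|u0] h1 h2; first by rewrite mulr0.
  rewrite -(ler_pM2r u0); apply: le_trans h2.
  have -> : c ^+ 2 * u * u = (c * u) ^+ 2 by ring.
  by rewrite ler_pXn2r // nnegrE ?(le_trans _ h1) // mulr_ge0 // ltW.
have injA y : A y = 0 -> y = 0.
  move=> y0; apply: (rip_eq0 hip); apply/eqP; rewrite eq_le rip_ge0 // andbT.
  have := lb y; rewrite y0 rip0l pmulr_rle0 // exprn_gt0 //.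
have [B AB] := choice (fun x => selfadjoint_pos_surj x c0 sA).
have BA y : B (A y) = y.
  by apply/eqP; rewrite -subr_eq0; apply/eqP/injA; rewrite (linfunB lA) AB subrr.
exists B; split; [|by apply/funext|by apply/funext].
apply: (@rnorm_bounded_operator _ c^-1) => [a u v|y].
  by apply/eqP; rewrite -subr_eq0; apply/eqP/injA; rewrite (linfunB lA) lA !AB subrr.
rewrite ler_rnorm ?invr_ge0 ?(ltW c0) // exprVn ler_pdivlMl ?exprn_gt0 //.
by have := lb (B y); rewrite AB.
Qed.

(** Put [y = B x]. The lower bound is [psd_sqr_le] at [y]; the upper one combines [c * '[y] <=
    '[A y, y]] with Cauchy-Schwarz for [x] and [y]. *)
Lemma selfadjoint_inv A B c d : 0 < c -> 0 <= d -> selfadjoint_in A c d ->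
  is_inverse A B -> selfadjoint_in B d^-1 c^-1.
Proof.
move=> c0 d0 sA [[lB _] AB BA]; have [lA symA bA] := sA.
have ABx x : A (B x) = x by have := congr1 (@^~ x) AB.
split=> // x; first by move=> y; rewrite -{1}(ABx y) -symA ABx.
have /andP[b1 b2] := bA (B x).
have := psd_sqr_le (B x) d0 (selfadjoint_inW (ltW c0) (lexx d) sA).
have := rip_cauchy_schwarz x (B x).
have := rip_ge0 hip (B x); have := rip_ge0 hip x.
move: b1 b2; rewrite !ABx (ripC ip (B x) x).
set p := '[x, B x]; set q := '[x]; set u := '[B x].
move=> h1 h2 q0 u0 h3 h4; apply/andP; split.
  (* For [d = 0] the convention [0^-1 = 0] leaves only positivity to prove. *)
  have := d0; rewrite le0r => /predU1P[->|d1]; last by rewrite ler_pdivrMl.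
  rewrite invr0 mul0r; apply: le_trans h1; rewrite mulr_ge0 // ltW //.
rewrite ler_pdivlMl //.
have : 0 <= p by apply: le_trans h1; rewrite mulr_ge0 // ltW.
rewrite le0r => /predU1P[->|p0]; first by rewrite mulr0.
rewrite -(ler_pM2l p0); have : c * p ^+ 2 <= c * (q * u) by rewrite ler_wpM2l // ltW.
nra.
Qed.

End SelfAdjoint.

(** * Polynomials of an operator and its spectrum *)

Section PolynomialCalculus.
Variables (R : realType) (H : completeNormedModType R[i]).
Variable A : H -> H.
Hypothesis lA : linear A.
Implicit Types (p q : {poly R[i]}) (x y : H).

(** Complex coefficients allow a real polynomial of [A] to be split into linear factors. *)
Definition cop_horner p x : H := \sum_(i < size p) p`_i *: iter i A x.

Lemma cop_horner_wide n p x : (size p <= n)%N ->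
  cop_horner p x = \sum_(i < n) p`_i *: iter i A x.
Proof.
move=> pn; rewrite /cop_horner (big_ord_widen n (fun i => p`_i *: iter i A x)) //.
rewrite big_mkcond; apply: eq_bigr => i _; case: ltnP => // pi.
by rewrite nth_default // scale0r.
Qed.

Lemma cop_hornerD p q x : cop_horner (p + q) x = cop_horner p x + cop_horner q x.
Proof.
pose n := maxn (size p) (size q).
rewrite !(@cop_horner_wide n) ?leq_maxl ?leq_maxr // ?(leq_trans (size_polyD _ _)) //.
by rewrite -big_split; apply: eq_bigr => i _; rewrite coefD scalerDl.
Qed.

Lemma cop_hornerZ a p x : cop_horner (a *: p) x = a *: cop_horner p x.
Proof.
rewrite !(@cop_horner_wide (size p)) ?size_scale_leq // scaler_sumr.
by apply: eq_bigr => i _; rewrite coefZ scalerA.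
Qed.

Lemma cop_hornerC a x : cop_horner a%:P x = a *: x.
Proof.
by rewrite (@cop_horner_wide 1) ?size_polyC_leq1 // big_ord1 coefC.
Qed.

Lemma cop_hornerMX p x : cop_horner (p * 'X) x = cop_horner p (A x).
Proof.
rewrite (@cop_horner_wide (size p).+1); last first.
  by rewrite (leq_trans (size_polyMleq _ _)) // size_polyX addn2.
rewrite big_ord_recl coefMX eqxx scale0r add0r; apply: eq_bigr => i _.
by rewrite coefMX /= -iterS iterSr.
Qed.

Lemma cop_horner_linear p : linear (cop_horner p).
Proof.
move=> a x y; elim/poly_ind: p a x y => [|p c IH] a x y.
  by rewrite /cop_horner size_poly0 !big_ord0 scaler0 addr0.
rewrite !cop_hornerD !cop_hornerMX !cop_hornerC lA IH !scalerDr.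
by rewrite addrACA !scalerA (mulrC c).
Qed.

Lemma cop_horner_comm p x : cop_horner p (A x) = A (cop_horner p x).
Proof.
rewrite /cop_horner (linfun_sum lA); apply: eq_bigr => i _.
by rewrite (linfunZ lA) -iterS iterSr.
Qed.

Lemma cop_hornerM p q x : cop_horner (p * q) x = cop_horner p (cop_horner q x).
Proof.
elim/poly_ind: p q x => [|p c IH] q x.
  by rewrite mul0r /cop_horner size_poly0 !big_ord0.
rewrite mulrDl -mulrA (mulrC 'X) mul_polyC !cop_hornerD cop_hornerZ cop_hornerC.
by rewrite !cop_hornerMX IH cop_hornerMX cop_horner_comm.
Qed.

Lemma cop_horner_XsubC a x : cop_horner ('X - a%:P) x = A x - a *: x.
Proof.
rewrite -polyCN cop_hornerD cop_hornerC scaleNr; congr (_ - _).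
by rewrite -['X]mul1r cop_hornerMX cop_hornerC scale1r.
Qed.

Lemma op_hornerE (p : {poly R}) x :
  op_horner p A x = cop_horner (map_poly (real_complex R) p) x.
Proof.
rewrite /op_horner /cop_horner size_map_poly; apply: eq_bigr => i _.
by rewrite coef_map.
Qed.

End PolynomialCalculus.

Section RealPolynomialCalculus.
Variables (R : realType) (H : completeNormedModType R[i]).
Variable A : H -> H.
Hypothesis lA : linear A.
Implicit Types (p q : {poly R}) (x y : H).

Lemma op_horner_linear p : linear (op_horner p A).
Proof. by move=> a x y; rewrite !op_hornerE cop_horner_linear. Qed.

Lemma op_hornerD p q x : op_horner (p + q) A x = op_horner p A x + op_horner q A x.
Proof. by rewrite !op_hornerE rmorphD cop_hornerD. Qed.

Lemma op_hornerM p q x : op_horner (p * q) A x = op_horner p A (op_horner q A x).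
Proof. by rewrite !op_hornerE rmorphM /= cop_hornerM. Qed.

Lemma op_hornerC a x : op_horner a%:P A x = a%:C *: x.
Proof. by rewrite op_hornerE map_polyC /= cop_hornerC. Qed.

Lemma op_hornerX x : op_horner 'X A x = A x.
Proof.
by rewrite op_hornerE map_polyX -['X]subr0 -polyC0 cop_horner_XsubC // scale0r subr0.
Qed.

Lemma op_hornerZ a p x : op_horner (a *: p) A x = a%:C *: op_horner p A x.
Proof. by rewrite -mul_polyC op_hornerM op_hornerC. Qed.

Lemma op_hornerN p x : op_horner (- p) A x = - op_horner p A x.
Proof. by rewrite -scaleN1r op_hornerZ rmorphN scaleN1r. Qed.

Lemma op_hornerB p q x : op_horner (p - q) A x = op_horner p A x - op_horner q A x.
Proof. by rewrite op_hornerD op_hornerN. Qed.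

End RealPolynomialCalculus.

(** * Spectral points of self-adjoint operators *)

Section Spectrum.
Variables (R : realType) (H : completeNormedModType R[i]).
Variable ip : {dot H for @Num.conj R[i]}.
Hypothesis hip : inner_product_of ip.
Local Notation "''[' u , v ]" := (complex.Re (ip u v)).
Local Notation "''[' u ]" := '[u, u].
Local Notation nr := (rnorm ip).
Local Notation symm := (symmetric_op ip).
Implicit Types (x y z : H) (A B S T : H -> H).

Lemma bounded_operator_rnorm B : bounded_operator B ->
  exists2 k, 0 < k & forall x, nr (B x) <= k * nr x.
Proof.
case=> lB bB.
pose L : {linear H -> H} := HB.pack B (GRing.isLinear.Build _ _ _ _ B lB).
have /pinfty_ex_gt0 [k k0 kB] := (linear_boundedP L).1 bB.
have kE : k = (complex.Re k)%:C by rewrite RRe_real // gtr0_real.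
exists (complex.Re k); first by rewrite -ltcR -kE.
by move=> x; have := kB x; rewrite kE /= !(normE hip) -rmorphM lecR.
Qed.

Lemma cop_horner_rnorm A (k : R) q : 0 <= k -> linear A ->
  (forall x, nr (A x) <= k * nr x) ->
  exists2 l, 0 < l & forall x, nr (cop_horner A q x) <= l * nr x.
Proof.
move=> k0 lA kA; elim/poly_ind: q => [|q c [l l0 lq]].
  exists 1 => // x; rewrite /cop_horner size_poly0 big_ord0 mul1r.
  by rewrite rnorm0 // rnorm_ge0.
have rc : `|c| = (complex.Re `|c|)%:C by rewrite RRe_real // normr_real.
have c0 : 0 <= complex.Re `|c| by rewrite -lecR -rc normr_ge0.
exists (l * k + complex.Re `|c| + 1).
  by rewrite ltr_wpDl // addr_ge0 // mulr_ge0 // ltW.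
move=> x; rewrite cop_hornerD cop_hornerMX cop_hornerC.
apply: le_trans (rnormD hip _ _) _.
have -> : nr (c *: x) = complex.Re `|c| * nr x.
  by apply: complexI; rewrite -(normE hip) normrZ rc (normE hip) -rmorphM.
have := lq (A x).
have : l * nr (A x) <= l * (k * nr x) by rewrite ler_wpM2l // ltW.
have := rnorm_ge0 ip x; lra.
Qed.

(** Its failure says that 0 is an approximate eigenvalue of [T]. *)
Definition bounded_below T := exists2 e, 0 < e & forall y, e * nr y <= nr (T y).

Lemma bounded_below_comp S T :
  bounded_below S -> bounded_below T -> bounded_below (S \o T).
Proof.
move=> [e e0 eS] [f f0 fT]; exists (e * f); first by rewrite mulr_gt0.
by move=> y; apply: le_trans (eS _); rewrite -mulrA ler_wpM2l // ltW.
Qed.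

(** An inverse with bound [k] would bound the operator below by [k^-1]. *)
Lemma not_bounded_below_spectrum A (z : R[i]) :
  ~ bounded_below (fun x => A x - z *: x) -> spectrum A z.
Proof.
move=> nb [B [bB _ BA]]; apply: nb.
have [k k0 kB] := bounded_operator_rnorm bB; exists k^-1; first by rewrite invr_gt0.
move=> y; rewrite ler_pdivrMl //; apply: le_trans (kB _).
by have -> : B (A y - z *: y) = y by have := congr1 (@^~ y) BA.
Qed.

(** With [w = A y - a y], the value [ip w y] is real, so [w] is orthogonal to [i y] in the real form
    and the squared norm splits as ['[w] + b ^+ 2 * '[y]]. *)
Lemma symmetric_bounded_below A (a b : R) : linear A -> symm A -> b != 0 ->
  bounded_below (fun x => A x - (a +i* b) *: x).
Proof.
move=> lA sA b0; exists `|b|; first by rewrite normr_gt0.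
move=> y; rewrite ler_Mrnorm // real_normK ?num_real //.
pose w := A y - a%:C *: y.
have wE : A y - (a +i* b) *: y = w - b%:C *: ('i%C *: y).
  rewrite /w -addrA -opprD scalerA -scalerDl; congr (_ - _ *: _).
  by apply/eqP; rewrite eq_complex /= !(mulr0, mulr1, mul0r, subr0, addr0, add0r) !eqxx.
have wy : complex.Im (ip w y) = 0.
  have : ip w y = ip y w.
    by rewrite /w linearBl linearZl_LR linearBr /= dotZr_real sA.
  by rewrite (dotC ip y w); case: (ip w y) => e f [] /=; lra.
clearbody w; have w_iy : '[w, 'i%C *: y] = 0 by rewrite rip_ir.
have iy : '['i%C *: y] = '[y].
  rewrite linearZl_LR [in LHS]/= dotZr; case: (ip y y) => e f /=; ring.
rewrite wE !ripE (ripC ip _ w) w_iy iy; have := rip_ge0 hip w; lra.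
Qed.

(** A composition of maps bounded below is bounded below, so some linear factor fails to be; its
    root is real by [symmetric_bounded_below]. *)
Lemma cop_horner_not_bounded_below A q : linear A -> symm A -> q != 0 ->
  ~ bounded_below (cop_horner A q) ->
  exists2 r : R, q.[r%:C] = 0 & ~ bounded_below (fun x => A x - r%:C *: x).
Proof.
move=> lA sA q0; have [s qs] := closed_field_poly_normal q.
rewrite {1}qs => nb.
have {}nb : ~ bounded_below (cop_horner A (\prod_(z <- s) ('X - z%:P))).
  apply: contra_not nb => -[e e0 eP].
  have c0 : 0 < complex.Re `|lead_coef q|.
    by rewrite -ltcR RRe_real ?normr_real // normr_gt0 lead_coef_eq0.
  exists (complex.Re `|lead_coef q| * e); first by rewrite mulr_gt0.
  move=> y; rewrite cop_hornerZ -lecR -(normE hip) normrZ (normE hip).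
  rewrite -[`|lead_coef q|]RRe_real ?normr_real // -rmorphM lecR -mulrA.
  by rewrite ler_wpM2l // ltW.
have [z zs nz] : exists2 z, z \in s & ~ bounded_below (fun x => A x - z *: x).
  elim: s nb {qs} => [|z s IH].
    rewrite big_nil => -[]; exists 1 => // y.
    by rewrite -polyC1 cop_hornerC scale1r mul1r.
  rewrite big_cons => nb.
  have [bz|nz] := pselect (bounded_below (fun x => A x - z *: x)); last first.
    by exists z => //; rewrite inE eqxx.
  have [|w ws nw] := IH; last by exists w => //; rewrite inE ws orbT.
  apply: contra_not nb => /(bounded_below_comp bz) [e e0 eb]; exists e => // y.
  by rewrite cop_hornerM // cop_horner_XsubC //; exact: eb.
case: z => a b in zs nz *.
have [b0|b0] := eqVneq b 0; last by case: nz; exact: symmetric_bounded_below.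
rewrite b0 in zs nz; exists a => //.
by apply/eqP; rewrite -/(root _ _) qs rootZ ?lead_coef_eq0 // root_prod_XsubC.
Qed.

Lemma op_horner_symmetric A p : symm A -> symm (op_horner p A).
Proof.
move=> sA x y; rewrite /op_horner linear_sumlz linear_sumr.
apply: eq_bigr => i _; rewrite linearZl_LR /= dotZr_real; congr (_ * _).
by elim: (nat_of_ord i) x y => //= n IH x y; rewrite sA IH -iterSr.
Qed.

(** Crude bounds only; the sharp ones, read off the spectrum, are deduced from them. *)
Lemma selfadjoint_op_horner A c d p : selfadjoint_in ip A c d ->
  exists2 l, 0 < l & selfadjoint_in ip (op_horner p A) (- l) l.
Proof.
move=> sA; have [lA symA _] := sA.
have [k k0 kA] := bounded_operator_rnorm (selfadjoint_bounded hip sA).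
have [l l0 lp] := cop_horner_rnorm (map_poly (real_complex R) p) (ltW k0) lA kA.
exists l => //; split=> [||x].
- exact: op_horner_linear.
- exact: op_horner_symmetric.
have := rip_cauchy_schwarz hip (op_horner p A x) x.
have := lp x; rewrite -op_hornerE ler_rnorm ?(ltW l0) //.
have := rip_ge0 hip x; set u := '[x]; set v := '[_]; set w := '[_, _].
move=> u0 h1 h2; rewrite mulNr -ler_norml -(ler_pXn2r (n := 2)) ?nnegrE //.
  rewrite real_normK ?num_real // exprMn; apply: le_trans h2 _.
  by rewrite (expr2 u) mulrA ler_wpM2r.
by rewrite mulr_ge0 // ltW.
Qed.

(* The supremum of the numerical range of [p(A)] is an approximate eigenvalue
   of [p(A)]; factoring over C shows that [p] takes it at a spectral point. *)
Lemma op_horner_le_at_spectrum A c d (p : {poly R}) :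
  selfadjoint_in ip A c d -> (exists x : H, x != 0) ->
  exists2 r, spectrum A r%:C & forall x, '[op_horner p A x, x] <= p.[r] * '[x].
Proof.
move=> sA [x0 x0N]; have [lA symA _] := sA.
(* Here [l] is the supremum of the numerical range. A constant [q = l] is set apart because [l - q]
   is then zero and has no factors. *)
have main q : exists l : R, (forall x, '[op_horner q A x, x] <= l * '[x]) /\
    (q != l%:P -> exists2 r : R, spectrum A r%:C & q.[r] = l).
  have [k k0 [lT sT bT]] := selfadjoint_op_horner q sA.
  pose T := op_horner q A.
  pose E := [set '[T x, x] | x in [set x | '[x] = 1]].
  have scale x : x != 0 -> exists2 u : H, '[u] = 1 & '[T x, x] = '[T u, u] * '[x].
    move=> xN; have n0 : nr x != 0.
      by apply: contra_neq xN; exact: rnorm_eq0.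
    exists ((nr x)^-1%:C *: x).
      by rewrite !ripE -(rnorm_sqr hip); field.
    by rewrite /T (linfunZ lT) !ripE -[X in _ * X](rnorm_sqr hip); field.
  have supE : has_sup E.
    split; first by have [u u1 _] := scale _ x0N; exists '[T u, u]; exists u.
    exists k => _ [u /= u1 <-]; have /andP[_] := bT u.
    by rewrite u1 mulr1.
  pose l := sup E.
  have Tl x : '[T x, x] <= l * '[x].
    have [->|xN] := eqVneq x 0; first by rewrite /T (linfun0 lT) !rip0l mulr0.
    have [u u1 ->] := scale _ xN; rewrite ler_wpM2r ?rip_ge0 //.
    by apply: ub_le_sup; [exact: supE.2|exists u].
  exists l; split=> // ql.
  have lk : 0 <= l + k.
    have [u u1 _] := scale _ x0N; have := Tl u; have /andP[+ _] := bT u.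
    by rewrite u1 !mulr1 => h1 /(le_trans h1); rewrite -/T; lra.
  pose p' := l%:P - q.
  have Sin : selfadjoint_in ip (op_horner p' A) 0 (l + k).
    split=> [||x]; [exact: op_horner_linear|exact: op_horner_symmetric|].
    rewrite op_hornerB // op_hornerC !ripE mul0r subr_ge0 Tl /= mulrDl lerD2l.
    by have /andP[+ _] := bT x; rewrite mulNr lerNl.
  (* A lower bound [e] and [psd_sqr_le] would keep the numerical range below
     [l - e ^+ 2 / (l + k + 1)], against the choice of [l]. The added 1 makes the denominator
     positive. *)
  have nb : ~ bounded_below (op_horner p' A).
    case=> e e0 eS.
    suff : l <= l - e ^+ 2 / (l + k + 1).
      by rewrite lerBrDl gerDr leNgt divr_gt0 ?exprn_gt0 //; lra.
    apply: ge_sup => [|_ [u /= u1 <-]]; first exact: supE.1.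
    have := psd_sqr_le hip u lk Sin; have := eS u.
    rewrite ler_Mrnorm ?(ltW e0) // u1 mulr1 => h1 /(le_trans h1).
    rewrite op_hornerB // op_hornerC !ripE u1 mulr1 => h2.
    rewrite lerBrDr -lerBrDl ler_pdivrMr; last lra.
    have := Tl u; rewrite u1 mulr1 /T; lra.
  have p'0 : map_poly (real_complex R) p' != 0.
    by rewrite map_poly_eq0 subr_eq0 eq_sym.
  have [|r] := cop_horner_not_bounded_below lA symA p'0.
    by apply: contra_not nb => -[e e0 eP]; exists e => // y; rewrite op_hornerE.
  rewrite horner_map /= => pr nr; exists r.
    exact: not_bounded_below_spectrum.
  have /complexI := pr; rewrite hornerD hornerN hornerC => /eqP.
  by rewrite subr_eq0 => /eqP.
have [l [pl pr]] := main p.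
have [pE|pN] := eqVneq p l%:P; last first.
  by have [r sr prl] := pr pN; exists r => //; rewrite prl.
(* A constant [p] takes the right value everywhere, so any spectral point will do; ['X] supplies
   one. *)
have [l' [_]] := main 'X; case=> [|r sr _].
  apply/eqP => /(congr1 (fun p : {poly R} => size p)).
  by rewrite size_polyX size_polyC; case: eqP.
by exists r => //; rewrite pE hornerC -pE.
Qed.

(** For [r < c] the operator [A - r] is bounded below by a positive scalar, and for [r > d] so is
    [r - A]; either is invertible. *)
Lemma spectrum_selfadjoint A c d (r : R) : selfadjoint_in ip A c d ->
  spectrum A r%:C -> c <= r <= d.
Proof.
move=> sA; have [lA symA bA] := sA.
have sl : linear (fun x => A x - r%:C *: x).
  move=> a u v; rewrite lA scalerBr scalerDr !scalerA (mulrC a) opprD.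
  by rewrite addrACA.
have ss : symm (fun x => A x - r%:C *: x).
  by move=> x y; rewrite linearBl linearZl_LR linearBr /= dotZr_real symA.
move=> spr; apply/andP; split; rewrite leNgt; apply/negP => lt_r; apply: spr.
- apply: (@selfadjoint_pos_invertible _ _ _ hip _ (c - r) (d - r)).
    by rewrite subr_gt0.
  split=> // x; have /andP[b1 b2] := bA x.
  by rewrite !ripE !mulrBl; apply/andP; split; lra.
- have sN : selfadjoint_in ip (fun x => r%:C *: x - A x) (r - d) (r - c).
    split=> [a u v|x y|x].
    + by rewrite -opprB sl opprD -scalerN !opprB.
    + by rewrite -opprB linearNl /= ss -linearNr opprB.
    + by have /andP[b1 b2] := bA x; rewrite !ripE !mulrBl; apply/andP; split; lra.
  have rd : 0 < r - d by rewrite subr_gt0.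
  have [B [[lB bB] AB BA]] := selfadjoint_pos_invertible hip rd sN.
  have [k k0 kB] := bounded_operator_rnorm (conj lB bB).
  (* An inverse of [r - A] becomes one of [A - r] after a change of sign. *)
  exists (fun x => B (- x)); split.
  + apply: (@rnorm_bounded_operator _ _ _ hip _ k) => [a u v|x].
      by rewrite opprD -scalerN lB.
    by have := kB (- x); rewrite -[- x]sub0r (rnormBC hip 0) subr0 sub0r.
  + apply/funext => x; have := congr1 (@^~ (- x)) AB => /= E.
    by rewrite -[LHS]opprB E opprK.
  + by apply/funext => x; have := congr1 (@^~ x) BA => /= E; rewrite opprB E.
Qed.

End Spectrum.

(** * Polynomial approximation of powers *)

Section Bernstein.
Variable R : realType.
Implicit Types (u p : {poly R}) (f : R -> R) (g h : nat -> R) (c d e x : R).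

(* With [u] the probability of success, evaluates the expectation of [g] at the
   number of successes in [n] independent trials. *)
Fixpoint bernstein u g n : {poly R} := match n with
  | 0 => (g 0)%:P
  | n.+1 => (1 - u) * bernstein u g n + u * bernstein u (g \o succn) n
  end.

Lemma bernstein_le u g h n x : 0 <= u.[x] <= 1 ->
  (forall k, (k <= n)%N -> g k <= h k) ->
  (bernstein u g n).[x] <= (bernstein u h n).[x].
Proof.
move=> /andP[u0 u1]; elim: n g h => [|n IH] g h gh.
  by rewrite /= !hornerC gh.
rewrite /= !(hornerD, hornerM, hornerN) hornerC; apply: lerD.
  by rewrite ler_wpM2l ?subr_ge0 //; apply: IH => k kn; rewrite gh // leqW.
by rewrite ler_wpM2l //; apply: IH => k kn; exact: gh.
Qed.

(** The mean and variance of the binomial law, with success probability [u]. *)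
Lemma bernstein_quadratic u (a b v : R) n x :
  (bernstein u (fun k => a + b * (k%:R - v) ^+ 2) n).[x] =
  a + b * ((n%:R * u.[x] - v) ^+ 2 + n%:R * u.[x] * (1 - u.[x])).
Proof.
elim: n v => [|n IH] v; first by rewrite /= hornerC; ring.
(* A success moves the count by one, that is, the centre [v] to [v - 1]. *)
have -> : bernstein u (fun k => a + b * (k%:R - v) ^+ 2) n.+1 =
  (1 - u) * bernstein u (fun k => a + b * (k%:R - v) ^+ 2) n +
  u * bernstein u (fun k => a + b * (k%:R - (v - 1)) ^+ 2) n.
  congr (_ + _ * bernstein _ _ _); apply/funext => k /=.
  by rewrite -natr1; congr (_ + _ * _ ^+ 2); ring.
rewrite !(hornerD, hornerM, hornerN) hornerC !IH -natr1; ring.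
Qed.

Definition polynomially_approximable f c d := forall e, 0 < e ->
  exists p : {poly R}, forall x, c <= x <= d -> `|f x - p.[x]| <= e.

(** Bernstein's proof of the Weierstrass theorem: a Lipschitz error is dominated by a quadratic in
    the number of successes, whose expectation is explicit. *)
Lemma lipschitz_approximable f c d L :
  (forall x y, c <= x <= d -> c <= y <= d -> `|f x - f y| <= L * `|x - y|) ->
  polynomially_approximable f c d.
Proof.
move=> fL e e0; have [dc|cd] := leP d c.
  exists (f c)%:P => x /andP[cx xd]; rewrite hornerC.
  have -> : x = c by apply/eqP; rewrite eq_le cx (le_trans xd).
  by rewrite subrr normr0 ltW.
have L0 : 0 <= L.
  have := fL d c; rewrite !lexx (ltW cd) => /(_ isT isT) h.
  have dc0 : 0 < `|d - c| by rewrite normr_gt0 subr_eq0 gt_eqF.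
  by rewrite -(pmulr_lge0 _ dc0); exact: le_trans h.
have w0 : 0 < d - c by rewrite subr_gt0.
have wN : d - c != 0 by rewrite gt_eqF.
pose eta := e / (L + 1); have eta0 : 0 < eta by rewrite divr_gt0 // ltr_wpDl.
have etaN : eta != 0 by rewrite gt_eqF.
have Leta : L * eta <= e.
  by rewrite /eta mulrCA ger_pMr // ler_pdivrMr ?ltr_wpDl // mul1r lerDl.
(* For [n >= K] the variance term is at most [e / 2]; the choice of [eta] leaves the other [e / 2]
   for [L * eta / 2]. *)
pose K := L * (d - c) ^+ 2 / (eta * e).
have K0 : 0 <= K.
  by apply: divr_ge0; apply: mulr_ge0; rewrite ?sqr_ge0 ?(ltW eta0) ?(ltW e0).
pose n := (Num.truncn K).+1; have nK : K <= n%:R.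
  by rewrite ltW // truncnS_gt.
have n0 : 0 < n%:R :> R by rewrite ltr0n.
have nN : n%:R != 0 :> R by rewrite gt_eqF.
clearbody n.
pose u : {poly R} := (d - c)^-1 *: ('X - c%:P).
pose node k : R := c + (d - c) * k%:R / n%:R.
exists (bernstein u (f \o node) n) => x /andP[cx xd].
have ux : u.[x] = (x - c) / (d - c) by rewrite /u !hornerE mulrC.
have u01 : 0 <= u.[x] <= 1.
  by rewrite ux divr_ge0 ?subr_ge0 ?(ltW cd) //= ler_pdivrMr // mul1r lerB.
have xE : x = c + (d - c) * u.[x] by rewrite ux; field.
pose b := L * ((d - c) / n%:R) ^+ 2 / (2 * eta).
have b0 : 0 <= b.
  by apply: divr_ge0; apply: mulr_ge0; rewrite ?sqr_ge0 ?(ltW eta0).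
have fnode k : (k <= n)%N ->
    `|f (node k) - f x| <= L * eta / 2 + b * (k%:R - n%:R * u.[x]) ^+ 2.
  move=> kn; have ncd : c <= node k <= d.
    rewrite /node lerDl divr_ge0 ?mulr_ge0 ?(ltW w0) //= -lerBrDl.
    by rewrite -mulrA ger_pMr // ler_pdivrMr // mul1r ler_nat.
  have xcd : c <= x <= d by rewrite cx.
  apply: le_trans (fL _ _ ncd xcd) _; set z := node k - x.
  have zE : z = (d - c) / n%:R * (k%:R - n%:R * u.[x]).
    by rewrite /z {1}xE /node; field; exact: nN.
  have -> : L * eta / 2 + b * (k%:R - n%:R * u.[x]) ^+ 2
      = L * (eta / 2 + z ^+ 2 / (2 * eta)).
    rewrite zE /b; field. by rewrite ?nN ?etaN.
  (* Arithmetic-geometric mean: the absolute value of [z] is at most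
     [eta / 2 + z ^+ 2 / (2 * eta)]. *)
  rewrite ler_wpM2l // -(real_normK (num_real z)).
  rewrite -subr_ge0; have -> : eta / 2 + `|z| ^+ 2 / (2 * eta) - `|z| =
     (eta - `|z|) ^+ 2 / (2 * eta) by field.
  by rewrite divr_ge0 ?sqr_ge0 // mulr_ge0 // ltW.
have bound : L * eta / 2 + b * (n%:R * u.[x] * (1 - u.[x])) <= e.
  have -> : b * (n%:R * u.[x] * (1 - u.[x])) =
    (K / n%:R) * (e / 2) * (u.[x] * (1 - u.[x])).
    by rewrite /b /K; field; rewrite etaN nN gt_eqF.
  have Kn : K / n%:R <= 1 by rewrite ler_pdivrMr // mul1r.
  have Kn0 : 0 <= K / n%:R by rewrite divr_ge0 // ltW.
  have [u0 u1] := andP u01.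
  have uu : u.[x] * (1 - u.[x]) <= 1 by nra.
  have uu0 : 0 <= u.[x] * (1 - u.[x]) by rewrite mulr_ge0 ?subr_ge0.
  have : K / n%:R * (e / 2) <= 1 * (e / 2) by rewrite ler_wpM2r ?divr_ge0 // ltW.
  have : 0 <= K / n%:R * (e / 2) by rewrite mulr_ge0 // divr_ge0 // ltW.
  nra.
rewrite ler_distlC; apply/andP; split.
- apply: (le_trans (y := (bernstein u (fun k => f x - L * eta / 2 +
      (- b) * (k%:R - n%:R * u.[x]) ^+ 2) n).[x])).
    rewrite bernstein_quadratic subrr expr0n add0r mulNr; lra.
  apply: bernstein_le => // k /fnode; rewrite ler_norml => /andP[h _] /=; lra.
- apply: (le_trans (y := (bernstein u (fun k => f x + L * eta / 2 +
      b * (k%:R - n%:R * u.[x]) ^+ 2) n).[x])).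
    apply: bernstein_le => // k /fnode; rewrite ler_norml => /andP[_ h] /=; lra.
  rewrite bernstein_quadratic subrr expr0n add0r; lra.
Qed.

(** The power is monotone, in a direction given by the sign of [s]; the sum covers both cases. *)
Lemma powR_le_ends c d (s : R) x : 0 < c -> c <= x <= d ->
  x `^ s <= c `^ s + d `^ s.
Proof.
move=> c0 /andP[cx xd]; have x0 := lt_le_trans c0 cx; have d0 := lt_le_trans x0 xd.
have [s0|s0] := leP 0 s.
  apply: (@le_trans _ _ (d `^ s)); last by rewrite lerDr powR_ge0.
  by rewrite ge0_ler_powR ?nnegrE // ltW.
apply: (@le_trans _ _ (c `^ s)); last by rewrite lerDl powR_ge0.
rewrite -(opprK s) !(powRN _ (- s)) lef_pV2 ?posrE ?powR_gt0 //.
by rewrite ge0_ler_powR ?nnegrE ?oppr_ge0 // ltW.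
Qed.

(** Away from 0 the derivative is bounded, so the mean value theorem makes the power Lipschitz. *)
Lemma powR_approximable c d (s : R) : 0 < c ->
  polynomially_approximable (fun r => r `^ s) c d.
Proof.
move=> c0; pose b := c `^ (s - 1) + d `^ (s - 1).
suff lip x y : x <= y -> c <= x <= d -> c <= y <= d ->
    `|x `^ s - y `^ s| <= `|s| * b * `|x - y|.
  apply: (@lipschitz_approximable _ _ _ (`|s| * b)) => x y xcd ycd.
  have [xy|/ltW yx] := leP x y; first exact: lip.
  by rewrite distrC (distrC x); exact: lip.
move=> xy /andP[cx xd] /andP[cy yd]; have x0 := lt_le_trans c0 cx.
have dpow z : x <= z -> is_derive z 1 (fun r => r `^ s) (s * z `^ (s - 1)).
  by move=> xz; apply: is_derive1_powR; exact: lt_le_trans xz.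
have [||z zxy E] := @MVT_segment R (fun r => r `^ s) (fun z => s * z `^ (s - 1)) x y xy.
- by move=> z; rewrite in_itv /= => /andP[xz _]; apply: dpow; exact: ltW.
- apply: derivable_within_continuous => z; rewrite in_itv /= => /andP[xz _].
  by have [] := dpow z xz.
rewrite distrC E normrM (distrC x); rewrite ler_wpM2r // normrM ler_wpM2l //.
move: zxy; rewrite in_itv /= => /andP[xz zy].
rewrite ger0_norm ?powR_ge0 //; apply: powR_le_ends => //.
by rewrite (le_trans cx) //= (le_trans zy).
Qed.

(** Concavity of the power: the right side is its tangent at [l]. Scaling by [l] reduces it to
    [y ^ t <= 1 - t + t y]. *)
Lemma powR_le_tangent (l r t : R) : 0 < l -> 0 < r -> 0 <= t <= 1 ->
  r `^ t <= l `^ t * (1 - t) + l `^ t * t / l * r.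
Proof.
move=> l0 r0 /andP[t0 t1]; have rl : 0 < r / l by rewrite divr_gt0.
have -> : r `^ t = l `^ t * (r / l) `^ t.
  by rewrite -powRM ?ltW // mulrC divfK // gt_eqF.
have -> : l `^ t * (1 - t) + l `^ t * t / l * r = l `^ t * (1 - t + t * (r / l)).
  by field; rewrite gt_eqF.
rewrite ler_pM2l ?powR_gt0 //; set y := r / l.
(* Factor [y ^ t] out of 1 and [y], and bound both remaining exponentials by [1 + u <= exp u]; the
   weighted linear terms cancel. *)
have -> : y `^ t = expR (t * ln y) by rewrite /powR gt_eqF.
have {2}-> : y = expR (t * ln y) * expR ((1 - t) * ln y).
  by rewrite -expRD -mulrDl addrC subrK mul1r lnK ?posrE.
have {1}-> : 1 - t = (1 - t) * (expR (t * ln y) * expR (- (t * ln y))).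
  by rewrite -expRD subrr expR0 mulr1.
have := expR_ge1Dx ((1 - t) * ln y); have := expR_ge1Dx (- (t * ln y)).
have := expR_gt0 (t * ln y).
set E := expR (t * _); set F := expR (- _); set G := expR _; set a := ln y.
move=> E0 h1 h2.
have -> : (1 - t) * (E * F) + t * (E * G) = E * ((1 - t) * F + t * G) by ring.
rewrite -[X in X <= _]mulr1 ler_pM2l //.
have h3 : (1 - t) * (1 - t * a) <= (1 - t) * F by rewrite ler_wpM2l ?subr_ge0.
have h4 : t * (1 + (1 - t) * a) <= t * G by rewrite ler_wpM2l.
lra.
Qed.

End Bernstein.

(** * Functional calculus *)

Section FunctionalCalculus.
Variables (R : realType) (H : completeNormedModType R[i]).
Variable ip : {dot H for @Num.conj R[i]}.
Hypothesis hip : inner_product_of ip.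
Local Notation "''[' u , v ]" := (complex.Re (ip u v)).
Local Notation "''[' u ]" := '[u, u].
Local Notation nr := (rnorm ip).
Local Notation symm := (symmetric_op ip).
Implicit Types (x y z : H) (B C : H -> H) (f g : R -> R) (p : {poly R}).

Variables (A : H -> H) (c d : R).
Hypothesis sA : selfadjoint_in ip A c d.

Let lA : linear A. Proof. by case: sA. Qed.

(** A spectral point controls [p - (a + b X)]. Constants will give operator bounds, tangents
    McCarthy's inequality. *)
Lemma op_horner_le_affine p (a b : R) x :
  (forall r : R, spectrum A r%:C -> p.[r] <= a + b * r) ->
  '[op_horner p A x, x] <= a * '[x] + b * '[A x, x].
Proof.
move=> pab; have [->|x0] := eqVneq x 0.
  by rewrite (linfun0 (op_horner_linear lA p)) (linfun0 lA) !rip0l !mulr0 addr0.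
have [|r sr] := op_horner_le_at_spectrum hip (p - (a%:P + b *: 'X)) sA.
  by exists x.
move/(_ x); rewrite op_hornerB // op_hornerD // op_hornerC op_hornerZ // op_hornerX //.
rewrite !hornerE !ripE => h; have := pab _ sr; have := rip_ge0 hip x.
nra.
Qed.

Lemma op_horner_rnorm p (e : R) x : 0 < e ->
  (forall r : R, spectrum A r%:C -> `|p.[r]| <= e) ->
  nr (op_horner p A x) <= e * nr x.
Proof.
move=> e0 pe; apply: selfadjoint_rnorm => //; split=> [||y].
- exact: op_horner_linear.
- by apply: op_horner_symmetric; case: sA.
apply/andP; split.
  have := @op_horner_le_affine (- p) e 0 y; rewrite op_hornerN // ripNl mul0r addr0.
  rewrite mulNr lerNl; apply=> r /pe; rewrite hornerN mul0r addr0 ler_norml.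
  by rewrite lerNl => /andP[].
have := @op_horner_le_affine p e 0 y; rewrite mul0r addr0; apply=> r /pe.
by rewrite mul0r addr0 ler_norml => /andP[].
Qed.

(** The functional calculus in a form with one polynomial per tolerance, close to [f] on the
    spectrum and to [B] in operator norm. *)
Definition op_approx f B := forall e, 0 < e -> exists p : {poly R},
  (forall r : R, spectrum A r%:C -> `|f r - p.[r]| <= e) /\
  forall x, nr (op_horner p A x - B x) <= e * nr x.

Lemma is_op_fun_approx f B : is_op_fun f A B -> op_approx f B.
Proof.
case=> _ [p [pf pB]] e e0.
have [N _ fN] : \forall n \near \oo, forall r : R, spectrum A r%:C ->
    `|f r - (p n).[r]| <= e.
  apply: (pf [set h : R -> R | forall r : R, spectrum A r%:C -> `|f r - h r| <= e]).
  apply/uniform_nbhs; exists [set xy | `|xy.1 - xy.2| < e]; split.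
    by rewrite -entourage_ballE; exists e => //= -[x y]; rewrite /= -ball_normE.
  by move=> h /= he r /he /ltW.
have [N' _ BN] := pB e e0.
exists (p (maxn N N')); split=> [r sr|x]; first by apply: fN => //=; rewrite leq_maxl.
rewrite -lecR rmorphM /= -!(normE hip); apply: BN => /=; exact: leq_maxr.
Qed.

Lemma le0_eps (u k : R) : 0 <= k -> (forall e, 0 < e -> u <= e * k) -> u <= 0.
Proof.
move=> k0 uk; apply/ler_addgt0Pr => e e0; rewrite add0r.
apply: le_trans (uk (e / (k + 1)) _) _; first by rewrite divr_gt0 // ltr_wpDl.
by rewrite -mulrA ger_pMr // mulrC ler_pdivrMr ?ltr_wpDl // mul1r lerDl.
Qed.

Lemma rip_rnorm x y : `|'[x, y]| <= nr x * nr y.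
Proof.
rewrite -(ler_pXn2r (n := 2)) ?nnegrE ?mulr_ge0 ?rnorm_ge0 //.
by rewrite real_normK ?num_real // exprMn !rnorm_sqr // rip_cauchy_schwarz.
Qed.

(** Polynomials close on the spectrum are close at [A], by [op_horner_rnorm]. Operator identities
    thus reduce to identities of functions on the spectrum. *)
Lemma op_approx_unique f g B C : op_approx f B -> op_approx g C ->
  (forall r : R, spectrum A r%:C -> f r = g r) -> B = C.
Proof.
move=> fB gC fg; apply/funext => x; apply/eqP; rewrite -subr_eq0; apply/eqP.
apply: (rnorm_eq0 hip); apply/eqP; rewrite eq_le rnorm_ge0 andbT.
apply: (@le0_eps _ (4 * nr x)) => [|e e0]; first by rewrite mulr_ge0 ?rnorm_ge0.
have [p [pf pB]] := fB e e0; have [q [qg qC]] := gC e e0.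
have e20 : 0 < 2 * e by rewrite mulr_gt0.
have := @op_horner_rnorm (p - q) _ x e20; rewrite op_hornerB // => pq.
have {}pq : nr (op_horner p A x - op_horner q A x) <= 2 * e * nr x.
  apply: pq => r sr; have := pf r sr; have := qg r sr; rewrite fg // hornerD hornerN.
  by rewrite !ler_norml => /andP[? ?] /andP[? ?]; apply/andP; split; lra.
have := pB x; have := qC x; rewrite (rnormBC hip (op_horner p A x)) => h1 h2.
have := rnormD hip (B x - op_horner p A x) (op_horner p A x - C x).
have := rnormD hip (op_horner p A x - op_horner q A x) (op_horner q A x - C x).
rewrite !subrKA; lra.
Qed.

Lemma op_approx_symmetric f B : linear B -> op_approx f B -> symm B.
Proof.
move=> lB fB.
have rB x y : '[B x, y] = '[x, B y].
  apply/eqP; rewrite -subr_eq0 -normr_le0.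
  apply: (@le0_eps _ (2 * (nr x * nr y))) => [|e e0].
    by rewrite !mulr_ge0 ?rnorm_ge0.
  have [p [_ pB]] := fB e e0.
  have sp : '[op_horner p A x, y] = '[x, op_horner p A y].
    by rewrite op_horner_symmetric //; case: sA.
  have -> : '[B x, y] - '[x, B y] =
      '[x, op_horner p A y - B y] - '[op_horner p A x - B x, y].
    by rewrite !ripE sp; ring.
  have := rip_rnorm x (op_horner p A y - B y).
  have := rip_rnorm (op_horner p A x - B x) y.
  have := rnorm_ge0 ip x; have := rnorm_ge0 ip y; have := pB x; have := pB y.
  move=> h1 h2 n1 n2 h3 h4.
  have h5 : nr x * nr (op_horner p A y - B y) <= nr x * (e * nr y) by rewrite ler_wpM2l.
  have h6 : nr (op_horner p A x - B x) * nr y <= e * nr x * nr y by rewrite ler_wpM2r.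
  have := ler_normB ('[x, op_horner p A y - B y]) ('[op_horner p A x - B x, y]).
  nra.
(* Real symmetry against [i x] equates the imaginary parts of [ip (B x) x] and its conjugate, so
   this value is real. *)
apply: (real_form_symmetric lB) => x.
apply/complex_realP; exists '[B x, x].
have : complex.Im (ip (B x) x) = complex.Im (ip x (B x)).
  by rewrite -!rip_ir rB (linfunZ lB).
rewrite (dotC ip x); case: (ip (B x) x) => a b /= ab.
by congr (_ +i* _); lra.
Qed.

Lemma op_approx_le_affine f B (a b : R) x : op_approx f B ->
  (forall r : R, spectrum A r%:C -> f r <= a + b * r) ->
  '[B x, x] <= a * '[x] + b * '[A x, x].
Proof.
move=> fB fab; rewrite -subr_le0.
apply: (@le0_eps _ (2 * '[x])) => [|e e0]; first by rewrite mulr_ge0 ?rip_ge0.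
have [p [pf pB]] := fB e e0.
have := @op_horner_le_affine p (a + e) b x; have := rip_rnorm (op_horner p A x - B x) x.
have : nr (op_horner p A x - B x) * nr x <= e * nr x * nr x.
  by rewrite ler_wpM2r ?rnorm_ge0.
rewrite -mulrA -expr2 rnorm_sqr // !ripE ler_norml => h1 /andP[h2 _] h3.
have {}h3 := h3 _; have : '[op_horner p A x, x] <= (a + e) * '[x] + b * '[A x, x].
  apply: h3 => r sr; have := fab r sr; have := pf r sr.
  by rewrite ler_norml => /andP[? _]; lra.
lra.
Qed.

Lemma op_approxN f B : op_approx f B -> op_approx (fun r => - f r) (fun x => - B x).
Proof.
move=> fB e e0; have [p [pf pB]] := fB e e0; exists (- p); split=> [r sr|x].
  by rewrite hornerN -opprD normrN pf.
by rewrite op_hornerN // opprK addrC (rnormBC hip) pB.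
Qed.

Lemma op_approx_selfadjoint f B (a b : R) : linear B -> op_approx f B ->
  (forall r : R, spectrum A r%:C -> a <= f r <= b) -> selfadjoint_in ip B a b.
Proof.
move=> lB fB fab; split=> //; first exact: op_approx_symmetric fB.
move=> x; apply/andP; split.
  have := @op_approx_le_affine _ _ (- a) 0 x (op_approxN fB).
  rewrite ripNl mul0r addr0 mulNr lerN2; apply=> r /fab /andP[? _].
  by rewrite mul0r addr0 lerN2.
have := @op_approx_le_affine _ _ b 0 x fB; rewrite mul0r addr0; apply.
by move=> r /fab /andP[_]; rewrite mul0r addr0.
Qed.

Lemma op_approx1 : op_approx (fun=> 1) id.
Proof.
move=> e e0; exists 1%:P; split=> [r _|x]; first by rewrite hornerC subrr normr0 ltW.
by rewrite op_hornerC scale1r subrr (rnorm0 hip) mulr_ge0 ?rnorm_ge0 // ltW.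
Qed.

Lemma op_approx_id : op_approx id A.
Proof.
move=> e e0; exists 'X; split=> [r _|x]; first by rewrite hornerX subrr normr0 ltW.
by rewrite op_hornerX // subrr (rnorm0 hip) mulr_ge0 ?rnorm_ge0 // ltW.
Qed.

Lemma op_approx_comp f g B C (K : R) : linear B -> bounded_operator C -> 0 <= K ->
  (forall r : R, spectrum A r%:C -> `|f r| <= K) ->
  (forall r : R, spectrum A r%:C -> `|g r| <= K) ->
  op_approx f B -> op_approx g C -> op_approx (fun r => f r * g r) (B \o C).
Proof.
move=> lB bC K0 fK gK fB gC e e0.
have [k k0 kC] := bounded_operator_rnorm hip bC.
(* [D] absorbs both errors: [(2 K + 1) e'] for the functions, [(K + k + 1) e'] for the operators.
   The cap [e' <= 1] bounds [p] by [K + 1] on the spectrum. *)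
pose D := 2 * K + k + 2; have D0 : 0 < D by rewrite /D; lra.
pose e' := Num.min 1 (e / D).
have e'0 : 0 < e' by rewrite /e' lt_min ltr01 divr_gt0.
have e'1 : e' <= 1 by rewrite /e' ge_min lexx.
have e'D : e' * D <= e by rewrite -ler_pdivlMr // /e' ge_min lexx orbT.
have [p [pf pB]] := fB e' e'0; have [q [qg qC]] := gC e' e'0.
have pK r : spectrum A r%:C -> `|p.[r]| <= K + 1.
  move=> sr; have := fK r sr; have := pf r sr.
  by rewrite !ler_norml => /andP[? ?] /andP[? ?]; apply/andP; split; lra.
exists (p * q); split=> [r sr|x].
  have -> : f r * g r - (p * q).[r] = (f r - p.[r]) * g r + p.[r] * (g r - q.[r]).
    by rewrite hornerM; ring.
  apply: le_trans (ler_normD _ _) _; rewrite !normrM.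
  have := ler_pM (normr_ge0 _) (normr_ge0 _) (pf r sr) (gK r sr).
  have := ler_pM (normr_ge0 _) (normr_ge0 _) (pK r sr) (qg r sr).
  rewrite /D in e'D; nra.
have K1 : 0 < K + 1 by lra.
have := op_horner_rnorm (op_horner q A x - C x) K1 pK.
rewrite (linfunB (op_horner_linear lA p)) -op_hornerM // => h1.
have := pB (C x); have := kC x; have := qC x; have := rnorm_ge0 ip x => n0 h2 h3 h4.
rewrite -(subrKA (op_horner p A (C x))); apply: le_trans (rnormD hip _ _) _.
have h5 : (K + 1) * nr (op_horner q A x - C x) <= (K + 1) * (e' * nr x).
  by rewrite ler_wpM2l // ltW.
have h6 : e' * nr (C x) <= e' * (k * nr x) by rewrite ler_wpM2l // ltW.
have h7 : e' * D * nr x <= e * nr x by rewrite ler_wpM2r.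
have h8 : 0 <= K * (e' * nr x) by rewrite !mulr_ge0 // ltW.
have h9 : 0 <= e' * nr x by rewrite mulr_ge0 // ltW.
rewrite /= /D in h7 *; lra.
Qed.

(** Approximations on [[c, d]] are approximations on the spectrum, so the [p n] of [A] are Cauchy in
    operator norm; completeness gives a pointwise limit, which inherits linearity and a bound. *)
Lemma is_op_fun_exists f : polynomially_approximable f c d ->
  exists B, is_op_fun f A B.
Proof.
move=> fp.
have inv0 n : 0 < n.+1%:R^-1 :> R by rewrite invr_gt0 ltr0n.
have [p pf] := choice (fun n : nat => fp _ (inv0 n)).
have {}pf n r : spectrum A r%:C -> `|f r - (p n).[r]| <= n.+1%:R^-1.
  by move=> /(spectrum_selfadjoint hip sA) /pf.
have small (e : R) : 0 < e -> exists N, forall n, (N <= n)%N -> n.+1%:R^-1 <= e.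
  move=> e0; exists (Num.truncn e^-1) => n Nn.
  rewrite -[e]invrK lef_pV2 ?posrE ?invr_gt0 // ?ltr0n //.
  apply: le_trans (ltW (truncnS_gt _)) _; by rewrite ler_nat ltnS.
have cauchy_p (e : R) : 0 < e -> exists N, forall n m, (N <= n)%N -> (N <= m)%N ->
    forall x, nr (op_horner (p n) A x - op_horner (p m) A x) <= e * nr x.
  move=> e0; have e20 : 0 < e / 2 by rewrite divr_gt0.
  have [N Ne] := small _ e20; exists N => n m Nn Nm x.
  rewrite -op_hornerB //; apply: op_horner_rnorm => // r sr.
  rewrite hornerD hornerN.
  have := le_trans (pf n r sr) (Ne n Nn); have := le_trans (pf m r sr) (Ne m Nm).
  by rewrite !ler_norml => /andP[? ?] /andP[? ?]; apply/andP; split; lra.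
have ptwise x : exists l, forall e : R, 0 < e -> exists N, forall n, (N <= n)%N ->
    nr (op_horner (p n) A x - l) <= e.
  apply: (cauchy_rnorm_cvg hip) => e e0.
  have e'0 : 0 < e / (nr x + 1) by rewrite divr_gt0 // ltr_wpDl ?rnorm_ge0.
  have [N Ne] := cauchy_p _ e'0; exists N => n m Nn Nm.
  apply: le_trans (Ne n m Nn Nm x) _.
  rewrite -mulrA ger_pMr // mulrC ler_pdivrMr ?ltr_wpDl ?rnorm_ge0 //.
  by rewrite mul1r lerDl.
have [B Bl] := choice ptwise.
have pB (e : R) : 0 < e -> exists N, forall n, (N <= n)%N ->
    forall x, nr (op_horner (p n) A x - B x) <= e * nr x.
  move=> e0; have [N Ne] := cauchy_p _ e0; exists N => n Nn x.
  apply/ler_addgt0Pr => e' e'0; have [N' Ne'] := Bl x _ e'0.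
  have := Ne' _ (leq_maxr N N'); have := Ne n _ Nn (leq_maxl N N') x.
  set y := op_horner (p (maxn N N')) A x => h1 h2.
  have := rnormD hip (op_horner (p n) A x - y) (y - B x); rewrite subrKA; lra.
have lB : linear B.
  move=> a x y; apply/eqP; rewrite -subr_eq0; apply/eqP.
  apply: (rnorm_eq0 hip); apply/eqP; rewrite eq_le rnorm_ge0 andbT.
  pose na := complex.Re `|a|.
  have na0 : 0 <= na by rewrite -lecR /na RRe_real ?normr_real ?normr_ge0.
  have nZ z : nr (a *: z) = na * nr z.
    apply: complexI; rewrite -(normE hip) normrZ (normE hip) rmorphM /=.
    by rewrite RRe_real ?normr_real.
  apply: (@le0_eps _ (nr (a *: x + y) + na * nr x + nr y)).
    by rewrite !addr_ge0 ?mulr_ge0 ?rnorm_ge0.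
  move=> e /pB [N /(_ N (leqnn N)) NB]; set T := op_horner (p N) A in NB.
  have -> : B (a *: x + y) - (a *: B x + B y) =
      (a *: (T x - B x) + (T y - B y)) - (T (a *: x + y) - B (a *: x + y)).
    rewrite /T (op_horner_linear lA) -/T scalerBr.
    by rewrite addrACA -opprD opprB [RHS]addrC subrKA.
  have := NB x; have := NB y; have := NB (a *: x + y) => h1 h2 h3.
  have := rnormD hip (a *: (T x - B x) + (T y - B y))
    (- (T (a *: x + y) - B (a *: x + y))).
  have := rnormD hip (a *: (T x - B x)) (T y - B y).
  have -> : nr (- (T (a *: x + y) - B (a *: x + y))) =
      nr (T (a *: x + y) - B (a *: x + y)).
    by rewrite opprB (rnormBC hip).
  have : nr (a *: (T x - B x)) <= na * (e * nr x) by rewrite nZ ler_wpM2l.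
  lra.
exists B; split.
  have [N /(_ N (leqnn N)) NB] := pB 1 ltr01.
  have [k k0 sN] := selfadjoint_op_horner hip (p N) sA.
  apply: (@rnorm_bounded_operator _ _ _ hip _ (k + 1)) => // x.
  have := NB x; have := selfadjoint_rnorm hip x k0 sN; rewrite (rnormBC hip) => h1 h2.
  rewrite -[B x](subrK (op_horner (p N) A x)).
  by apply: le_trans (rnormD hip _ _) _; lra.
exists p; split; last first.
  move=> e /pB [N NB]; exists N => // n Nn x.
  by rewrite !(normE hip) -rmorphM lecR; exact: NB.
move=> U /uniform_nbhs [E [entE EU]].
rewrite -entourage_ballE in entE; case: entE => e /= e0 eE.
have e20 : 0 < e / 2 by rewrite divr_gt0.
have [N Ne] := small _ e20; exists N => // n /= Nn; apply: EU => r /= sr.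
apply: eE; rewrite /= -ball_normE /=; apply: le_lt_trans (pf n r sr) _.
by apply: le_lt_trans (Ne n Nn) _; lra.
Qed.

(** Existence ensures that [xget] returns a genuine value and not its default 0. *)
Lemma op_fun_spec f : polynomially_approximable f c d ->
  bounded_operator (op_fun f A) /\ op_approx f (op_fun f A).
Proof.
move=> /is_op_fun_exists fB; have := xgetPex (fun=> 0) fB.
by move=> fB'; split; [case: fB'|exact: is_op_fun_approx fB'].
Qed.

End FunctionalCalculus.

(** * Powers and means of positive operators *)

Section OperatorPowers.
Variables (R : realType) (H : completeNormedModType R[i]).
Variable ip : {dot H for @Num.conj R[i]}.
Hypothesis hip : inner_product_of ip.
Local Notation "''[' u , v ]" := (complex.Re (ip u v)).
Local Notation "''[' u ]" := '[u, u].
Implicit Types (x y z : H) (A B C G P S T : H -> H) (s t : R).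

Section Power.
Variables (A : H -> H) (c d : R).
Hypotheses (c0 : 0 < c) (sA : selfadjoint_in ip A c d).

Let spectrum_gt0 (r : R) : spectrum A r%:C -> 0 < r.
Proof. by move=> /(spectrum_selfadjoint hip sA) /andP[+ _]; exact: lt_le_trans. Qed.

Lemma op_pow_bounded s : bounded_operator (op_pow A s).
Proof. exact: (op_fun_spec hip sA (powR_approximable d s c0)).1. Qed.

Lemma op_pow_linear s : linear (op_pow A s).
Proof. by have [] := op_pow_bounded s. Qed.

Lemma op_pow_approx s : op_approx ip A (fun r => r `^ s) (op_pow A s).
Proof. exact: (op_fun_spec hip sA (powR_approximable d s c0)).2. Qed.

Lemma op_pow_symmetric s : symmetric_op ip (op_pow A s).
Proof. exact: (op_approx_symmetric hip sA (op_pow_linear s) (op_pow_approx s)). Qed.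

(** The spectrum is positive, so the law of exponents need only be checked for [r > 0]. *)
Lemma op_pow_comp s s' g B : op_approx ip A g B ->
  (forall r, 0 < r -> r `^ s * r `^ s' = g r) ->
  forall x, op_pow A s (op_pow A s' x) = B x.
Proof.
move=> gB sg x; rewrite -[LHS]/((op_pow A s \o op_pow A s') x); congr (_ x).
apply: (op_approx_unique hip sA _ gB); last by move=> r /spectrum_gt0; exact: sg.
pose K := (c `^ s + d `^ s) + (c `^ s' + d `^ s').
apply: (@op_approx_comp _ _ _ hip _ _ _ sA _ _ _ _ K)
  (op_pow_approx s) (op_pow_approx s').
- exact: op_pow_linear.
- exact: op_pow_bounded.
- by rewrite !addr_ge0 ?powR_ge0.
- move=> r /(spectrum_selfadjoint hip sA) rcd; rewrite ger0_norm ?powR_ge0 //.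
  by rewrite (le_trans (powR_le_ends s c0 rcd)) // lerDl addr_ge0 ?powR_ge0.
- move=> r /(spectrum_selfadjoint hip sA) rcd; rewrite ger0_norm ?powR_ge0 //.
  by rewrite (le_trans (powR_le_ends s' c0 rcd)) // lerDr addr_ge0 ?powR_ge0.
Qed.

Lemma op_pow_half x : op_pow A 2^-1 (op_pow A 2^-1 x) = A x.
Proof.
apply: op_pow_comp (op_approx_id hip A) _ x => r r0.
rewrite -powRD ?(gt_eqF r0) ?implybT //.
have -> : 2^-1 + 2^-1 = 1 :> R by field.
by rewrite powRr1 // ltW.
Qed.

Lemma op_pow_halfN x : op_pow A 2^-1 (op_pow A (- 2^-1) x) = x.
Proof.
apply: op_pow_comp (op_approx1 hip A) _ x => r r0.
by rewrite -powRD ?(gt_eqF r0) ?implybT // subrr powRr0.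
Qed.

Lemma op_pow_Nhalf x : op_pow A (- 2^-1) (op_pow A 2^-1 x) = x.
Proof.
apply: op_pow_comp (op_approx1 hip A) _ x => r r0.
by rewrite mulrC -powRD ?(gt_eqF r0) ?implybT // subrr powRr0.
Qed.

Lemma op_pow_selfadjoint s : 0 <= s ->
  selfadjoint_in ip (op_pow A s) (c `^ s) (d `^ s).
Proof.
move=> s0; apply: (op_approx_selfadjoint hip sA (op_pow_linear s) (op_pow_approx s)).
move=> r /(spectrum_selfadjoint hip sA) /andP[cr rd].
have r0 := lt_le_trans c0 cr; have d0 := lt_le_trans r0 rd.
by rewrite !ge0_ler_powR ?nnegrE // ltW.
Qed.

(* McCarthy's inequality, from the tangent to [r `^ t] at [<Ax,x>]. *)
Lemma op_pow_mccarthy t x : 0 <= t <= 1 -> '[x] = 1 ->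
  '[op_pow A t x, x] <= '[A x, x] `^ t.
Proof.
move=> t01 x1; have [_ _ /(_ x)] := sA; rewrite x1 !mulr1 => /andP[cx _].
have l0 := lt_le_trans c0 cx; set l := '[A x, x] in l0 *.
have := @op_approx_le_affine _ _ _ hip _ _ _ sA _ _ (l `^ t * (1 - t))
  (l `^ t * t / l) x (op_pow_approx t).
rewrite x1 mulr1 -/l divfK ?gt_eqF // -mulrDr subrK mulr1; apply.
by move=> r /spectrum_gt0 r0; exact: powR_le_tangent.
Qed.

End Power.

Lemma op_invP A : op_invertible A -> is_inverse A (op_inv A).
Proof. exact: xgetPex. Qed.

(** * The geometric mean and the inequality for the spectral mean *)

Section SpectralMean.
Variables (A B : H -> H) (m M : R).
Hypotheses (m0 : 0 < m) (mM : m <= M).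
Hypotheses (sA : selfadjoint_in ip A m M) (sB : selfadjoint_in ip B m M).
Let P := op_inv A.
Let G := geometric_mean P B.
Let M0 : 0 < M. Proof. exact: lt_le_trans mM. Qed.
Let invP : is_inverse A P.
Proof. exact/op_invP/(selfadjoint_pos_invertible hip m0 sA). Qed.

Let AP x : A (P x) = x. Proof. by have [_ /(congr1 (@^~ x))] := invP. Qed.
Let PA x : P (A x) = x. Proof. by have [_ _ /(congr1 (@^~ x))] := invP. Qed.

Lemma op_inv_selfadjoint : selfadjoint_in ip P M^-1 m^-1.
Proof. exact: selfadjoint_inv (ltW M0) sA invP. Qed.

Let Mi0 : 0 < M^-1. Proof. by rewrite invr_gt0. Qed.
Let sP := op_inv_selfadjoint.
Let Q := op_pow P 2^-1.
Let Q' := op_pow P (- 2^-1).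
Let C := Q' \o B \o Q'.
Let D := op_pow C 2^-1.

Let symQ : symmetric_op ip Q. Proof. exact: op_pow_symmetric sP _. Qed.
Let symQ' : symmetric_op ip Q'. Proof. exact: op_pow_symmetric sP _. Qed.
Let QQ x : Q (Q x) = P x. Proof. exact: op_pow_half sP x. Qed.
Let QQ' x : Q (Q' x) = x. Proof. exact: op_pow_halfN sP x. Qed.
Let Q'Q x : Q' (Q x) = x. Proof. exact: op_pow_Nhalf sP x. Qed.
Let Q'Q' x : Q' (Q' x) = A x.
Proof. by rewrite -[x in LHS]PA -QQ !Q'Q. Qed.

Lemma congruence_selfadjoint S T a b k l : 0 <= a -> 0 <= b -> linear S ->
  symmetric_op ip S -> selfadjoint_in ip T a b ->
  (forall x, k * '[x] <= '[S x] <= l * '[x]) ->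
  selfadjoint_in ip (S \o T \o S) (a * k) (b * l).
Proof.
move=> a0 b0 lS symS [lT symT bT] bS; split=> [u x y|x y|x] /=.
- by rewrite lS lT lS.
- by rewrite symS symT symS.
rewrite (symmetric_rip _ _ symS); have /andP[b1 b2] := bT (S x).
have /andP[c1 c2] := bS x; apply/andP; split.
  by apply: le_trans b1; rewrite -mulrA ler_wpM2l.
by apply: le_trans b2 _; rewrite -mulrA ler_wpM2l.
Qed.

Let sC : selfadjoint_in ip C (m * m) (M * M).
Proof.
apply: congruence_selfadjoint; rewrite ?ltW //; first exact: op_pow_linear sP _.
by move=> x; rewrite -(symmetric_rip _ _ symQ') Q'Q'; case: sA.
Qed.

Let m20 : 0 < m * m. Proof. exact: mulr_gt0. Qed.

(** With [G = Q D Q] and [A = Q' Q'], the inner roots cancel and leave [Q D D Q = Q C Q = B].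
    Abstract maps keep the rewriting syntactic. *)
Lemma geometric_mean_riccati x : G (A (G x)) = B x.
Proof.
suff abs (q q' e a b : H -> H) : (forall y, q' (q' y) = a y) ->
    (forall y, q' (q y) = y) -> (forall y, q (q' y) = y) ->
    (forall y, e (e y) = q' (b (q' y))) ->
    q (e (q (a (q (e (q x)))))) = b x.
  exact: (abs Q Q' D A B Q'Q' Q'Q QQ' (op_pow_half m20 sC)).
by move=> h1 h2 h3 h4; rewrite -h1 h2 h3 h4 h3 h2.
Qed.

(** Bounds crude but positive, enough to invert [G]. *)
Let sG0 : exists a b, 0 < a /\ selfadjoint_in ip G a b.
Proof.
have sD : selfadjoint_in ip D ((m * m) `^ 2^-1) ((M * M) `^ 2^-1).
  by apply: op_pow_selfadjoint; rewrite ?invr_ge0.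
exists ((m * m) `^ 2^-1 * M^-1), ((M * M) `^ 2^-1 * m^-1).
split; first by rewrite mulr_gt0 // powR_gt0.
apply: congruence_selfadjoint; rewrite ?powR_ge0 //; first exact: op_pow_linear sP _.
by move=> x; rewrite -(symmetric_rip _ _ symQ) QQ; case: sP.
Qed.

Let GAG x : '[A (G x), G x] = '[B x, x].
Proof.
by have [a [b [_ [_ symG _]]]] := sG0; rewrite -geometric_mean_riccati symG.
Qed.

Lemma selfadjoint_le_rnorm S a b k : selfadjoint_in ip S a b -> 0 <= k ->
  (forall x, '[S x] <= k ^+ 2 * '[x]) -> selfadjoint_in ip S a k.
Proof.
move=> [lS symS bS] k0 Sk; split=> // x; have /andP[-> _] := bS x.
have := rip_rnorm hip (S x) x; rewrite -(rnorm_sqr hip x) => h.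
apply: le_trans (ler_norm _) _; apply: le_trans h _.
rewrite expr2 mulrA ler_wpM2r ?rnorm_ge0 // ler_rnorm //; exact: Sk.
Qed.

(** The identity [GAG] bounds [G x] in norm from both sides. The upper bound transfers directly; the
    lower one becomes a norm bound on the inverse [J], and inverting [J] gives it back. *)
Lemma geometric_mean_selfadjoint :
  selfadjoint_in ip G (Num.sqrt (m / M)) (Num.sqrt (m / M))^-1.
Proof.
have [a [b [a0 sG]]] := sG0; have [lG symG bG] := sG.
set g := Num.sqrt _.
have mM0 : 0 < m / M by rewrite divr_gt0.
have g0 : 0 < g by rewrite sqrtr_gt0.
have g2 : g ^+ 2 = m / M by rewrite sqr_sqrtr // ltW.
have gV2 : g^-1 ^+ 2 = M / m by rewrite exprVn g2 invf_div.
have [lA symA bA] := sA; have [lB symB bB] := sB.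
have Gup x : '[G x] <= g^-1 ^+ 2 * '[x].
  rewrite gV2 mulrAC ler_pdivlMr // mulrC.
  have /andP[+ _] := bA (G x); rewrite GAG => /le_trans; apply.
  by have /andP[_] := bB x.
have Glow x : g ^+ 2 * '[x] <= '[G x].
  rewrite g2 mulrAC ler_pdivrMr // mulrC [X in _ <= X]mulrC mulrC.
  have /andP[_] := bA (G x); rewrite GAG; apply: le_trans.
  by have /andP[+ _] := bB x; rewrite mulrC.
have [J invJ] := selfadjoint_pos_invertible hip a0 sG.
(* The maximum with [a] guarantees a positive upper bound, since the sign of [b] is unknown. *)
have b0 : 0 <= Num.max b a by rewrite le_max (ltW a0) orbT.
have sG' : selfadjoint_in ip G a (Num.max b a).
  by apply: (selfadjoint_inW hip _ _ sG); rewrite ?le_max lexx.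
have sJ := selfadjoint_inv hip a0 b0 sG' invJ.
have [bJ GJ JG] := invJ.
have {}sJ : selfadjoint_in ip J (Num.max b a)^-1 g^-1.
  apply: selfadjoint_le_rnorm sJ _ _; first by rewrite invr_ge0 ltW.
  move=> x; rewrite exprVn ler_pdivlMl ?exprn_gt0 //.
  by apply: le_trans (Glow (J x)) _; rewrite -[G (J x)]/((G \o J) x) GJ.
have sG1 : selfadjoint_in ip G g (Num.max b a)^-1^-1.
  rewrite -[g]invrK; apply: selfadjoint_inv sJ _ => //.
  - by rewrite invr_gt0 lt_max a0 orbT.
  - by rewrite invr_ge0 ltW.
  - by split=> //; exact: (selfadjoint_bounded hip sG).
by apply: selfadjoint_le_rnorm sG1 _ Gup; rewrite invr_ge0 ltW.
Qed.

(* With [W = A^{1/2} T A^{1/2}] this is the positivity of [(W - a)(b - W)];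
   Cauchy-Schwarz for the form of [T - a A^{-1}] gives it without the root. *)
Lemma kantorovich_congruence T k l x : 0 < k -> k <= l ->
  selfadjoint_in ip T k l ->
  '[A (T x), T x] + (m * k) * (M * l) * '[P x, x] <= (m * k + M * l) * '[T x, x].
Proof.
move=> k0 kl [lT symT bT]; pose a := m * k; pose b := M * l.
have [lP symP bP] := sP; have [lA symA bA] := sA.
have l0 : 0 < l := lt_le_trans k0 kl.
have ab : a <= b by rewrite ler_pM // ltW.
(* From [a P <= k <= T <= l <= b P] one gets [0 <= S <= (b - a) P]. *)
pose S y := T y - a%:C *: P y.
have lS : linear S.
  move=> c u v; rewrite /S lT lP scalerBr scalerDr !scalerA (mulrC c) opprD.
  by rewrite addrACA.
have symS : symmetric_op ip S.
  by move=> u v; rewrite /S linearBl linearZl_LR linearBr /= symT symP dotZr_real.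
have posS y : 0 <= '[S y, y].
  have /andP[+ _] := bT y; have /andP[_ +] := bP y; rewrite /S !ripE => h1 h2.
  rewrite subr_ge0; apply: le_trans h2.
  apply: (@le_trans _ _ (a * (m^-1 * '[y]))).
    by rewrite ler_wpM2l // mulr_ge0 // ltW.
  by rewrite /a (mulrC m) mulrA mulfK // gt_eqF.
have Sle y : '[S y, y] <= (b - a) * '[P y, y].
  have /andP[_ +] := bT y; have /andP[+ _] := bP y; rewrite /S !ripE => h1 h2.
  suff : '[T y, y] <= b * '[P y, y] by lra.
  apply: le_trans h2 _.
  apply: (@le_trans _ _ (b * (M^-1 * '[y]))); last first.
    by rewrite ler_wpM2l // mulr_ge0 // ltW.
  by rewrite /b (mulrC M) mulrA mulfK // gt_eqF.
(* This is [A (S x)], so [w] is also ['[P z, z]]. Cauchy-Schwarz and the bound on [S z] give [w ^+ 2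
   <= (b - a) * w * '[S x, x]], and a factor [w] cancels. *)
pose z := A (T x) - a%:C *: x.
have Pz : P z = S x by rewrite /z (linfunB lP) (linfunZ lP) PA.
pose w := '[S x, z].
have w0 : 0 <= w.
  rewrite /w -Pz; have /andP[+ _] := bP z; apply: le_trans.
  by rewrite mulr_ge0 ?rip_ge0 // ltW.
have wE : w = '[A (T x), T x] - 2 * a * '[T x, x] + a ^+ 2 * '[P x, x].
  rewrite /w /S /z !ripE (ripC ip (T x) (A (T x))).
  by rewrite (symmetric_rip x _ symP) PA (ripC ip x (T x)); ring.
have := psd_cauchy_schwarz x z lS symS posS; rewrite -/w => h.
have {}h : w <= (b - a) * '[S x, x].
  move: w0; rewrite le0r => /predU1P[->|w0]; first by rewrite mulr_ge0 ?subr_ge0.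
  rewrite -(ler_pM2r w0) -expr2; apply: le_trans h _.
  rewrite mulrAC [leLHS]mulrC ler_wpM2r //; apply: le_trans (Sle z) _.
  by rewrite Pz.
move: h; rewrite wE /S !ripE -/a -/b; nra.
Qed.

(** Cauchy-Schwarz for the form of [A] at [G x] and [P x], where [A] cancels [P]. *)
Lemma geometric_mean_rip_sqr x : '[G x, x] ^+ 2 <= '[B x, x] * '[P x, x].
Proof.
have [lA symA bA] := sA; have [_ symP _] := sP.
have psdA z : 0 <= '[A z, z].
  by have /andP[+ _] := bA z; apply: le_trans; rewrite mulr_ge0 ?rip_ge0 // ltW.
have := psd_cauchy_schwarz (G x) (P x) lA symA psdA.
by rewrite GAG (symmetric_rip _ _ symA) AP (ripC ip x (P x)).
Qed.

Lemma op_inv_rip_ge1 x : '[x] = 1 -> 1 <= '[A x, x] * '[P x, x].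
Proof.
move=> x1; have [lA symA bA] := sA.
have psdA z : 0 <= '[A z, z].
  by have /andP[+ _] := bA z; apply: le_trans; rewrite mulr_ge0 ?rip_ge0 // ltW.
have := psd_cauchy_schwarz x (P x) lA symA psdA.
by rewrite (symmetric_rip _ _ symA) AP x1 expr1n (ripC ip x (P x)).
Qed.

Lemma spectral_mean_rip_le t x : 0 <= t <= 1 -> '[x] = 1 ->
  '[A (op_pow G t x), op_pow G t x] <=
    (M `^ (1 + t) + m `^ (1 + t)) ^+ 2 / (4 * M `^ (1 + t) * m `^ (1 + t))
    * '[A x, x] `^ (1 - t) * '[B x, x] `^ t.
Proof.
move=> t01 x1; have [t0 t1] := andP t01.
set g := Num.sqrt (m / M).
have mM0 : 0 < m / M by rewrite divr_gt0.
have g0 : 0 < g by rewrite sqrtr_gt0.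
have sG : selfadjoint_in ip G g g^-1 := geometric_mean_selfadjoint.
have sT := op_pow_selfadjoint g0 sG t0.
set k := g `^ t in sT; have k0 : 0 < k by rewrite powR_gt0.
have kV : g^-1 `^ t = k^-1 by rewrite -(powR_inv1 (ltW g0)) -powRrM mulN1r powRN.
rewrite kV in sT.
have g1 : g <= 1.
  rewrite -sqrtr1 ler_sqrt // ler_pdivrMr // mul1r //.
have k1 : k <= 1.
  have -> : 1 = 1 `^ t :> R by rewrite powR1.
  by rewrite ge0_ler_powR ?nnegrE // ltW.
have kk : k <= k^-1 by rewrite (le_trans k1) // invf_ge1.
have k2 : k ^+ 2 = m `^ t / M `^ t.
  rewrite expr2 -powRM ?ltW // -expr2 sqr_sqrtr ?ltW //.
  rewrite powRM ?invr_ge0 ?(ltW m0) ?(ltW M0) //.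
  by rewrite -(powR_inv1 (ltW M0)) -powRrM mulN1r powRN.
have := kantorovich_congruence x k0 kk sT.
have := op_pow_mccarthy g0 sG t01 x1.
have := geometric_mean_rip_sqr x; have := op_inv_rip_ge1 x1.
have [_ _ /(_ x)] := sA; have [_ _ /(_ x)] := sB; have [_ _ /(_ x)] := sP.
have [_ _ /(_ x)] := sG; have [_ _ /(_ x)] := sT; rewrite x1 !mulr1.
set X := '[A (op_pow G t x), _]; set tau := '[op_pow G t x, x].
set al := '[A x, x]; set be := '[B x, x]; set p := '[P x, x]; set ga := '[G x, x].
move=> /andP[tau0 _] /andP[ga0 _] /andP[p0 _] /andP[be0 _] /andP[al0 _].
move=> h1 h2 h3 h4.
have {}tau0 := lt_le_trans k0 tau0; have {}ga0 := lt_le_trans g0 ga0.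
have {}p0 := lt_le_trans Mi0 p0; have {}be0 := lt_le_trans m0 be0.
have {}al0 := lt_le_trans m0 al0.
have powD (y a b : R) : 0 < y -> y `^ (a + b) = y `^ a * y `^ b.
  by move=> y0; rewrite powRD // (gt_eqF y0) implybT.
have mE : m `^ (1 + t) = m * m `^ t by rewrite powD // powRr1 // ltW.
have ME : M `^ (1 + t) = M * M `^ t by rewrite powD // powRr1 // ltW.
(* This is [(a + b) ^+ 2 / (4 a b)] for [a = m k], [b = M / k], with [a b = m M]. Substituting
   [m ^ t = k ^+ 2 * M ^ t] recovers the constant of the theorem. *)
pose K := (M * k^-1 + m * k) ^+ 2 / (4 * (m * M)).
have KE : (M `^ (1 + t) + m `^ (1 + t)) ^+ 2 / (4 * M `^ (1 + t) * m `^ (1 + t)) = K.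
  have mt : m `^ t = k ^+ 2 * M `^ t by rewrite k2 divfK // gt_eqF ?powR_gt0.
  rewrite mE ME mt /K; field.
  by rewrite !gt_eqF ?powR_gt0.
have XK : X * p <= K * tau ^+ 2.
  rewrite /K mulrAC ler_pdivlMr ?mulr_gt0 //.
  have abE : m * k * (M * k^-1) = m * M by field; rewrite gt_eqF.
  rewrite abE in h4; rewrite -exprMn.
  (* Arithmetic-geometric mean for [X] and [m M p], then the Kantorovich estimate [h4]. *)
  apply: (@le_trans _ _ ((X + m * M * p) ^+ 2)).
    rewrite -subr_ge0.
    have -> : (X + m * M * p) ^+ 2 - X * p * (4 * (m * M)) =
        (X - m * M * p) ^+ 2 by ring.
    exact: sqr_ge0.
  have X0 : 0 <= X.
    have [_ _ /(_ (op_pow G t x)) /andP[+ _]] := sA; apply: le_trans.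
    by rewrite mulr_ge0 ?rip_ge0 // ltW.
  have l0 : 0 <= X + m * M * p by rewrite addr_ge0 // !mulr_ge0 // ltW.
  have r0 : 0 <= (M * k^-1 + m * k) * tau.
    by rewrite mulr_ge0 ?addr_ge0 ?mulr_ge0 ?invr_ge0 // ltW.
  by rewrite ler_pXn2r ?nnegrE // (addrC (M * _)).
have tauB : tau ^+ 2 <= be `^ t * p `^ t.
  rewrite -powRM ?(ltW be0) ?(ltW p0) //; apply: (@le_trans _ _ ((ga ^+ 2) `^ t)).
    rewrite expr2 powRM ?(ltW ga0) // -expr2.
    by rewrite ler_pXn2r ?nnegrE ?powR_ge0 // ltW.
  by rewrite ge0_ler_powR ?nnegrE ?sqr_ge0 // ?mulr_ge0 // ltW.
have K0 : 0 <= K by rewrite divr_ge0 ?sqr_ge0 // !mulr_ge0 // ltW.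
rewrite KE -(ler_pM2r p0); apply: le_trans XK _.
apply: (@le_trans _ _ (K * (be `^ t * p `^ t))); first by rewrite ler_wpM2l.
(* What remains after cancelling [K] and the power of [be]; dividing by [p ^ t] turns it into
   [1 <= (al p) ^ (1 - t)]. *)
suff : p `^ t <= al `^ (1 - t) * p.
  move=> h; have -> : K * al `^ (1 - t) * be `^ t * p =
      K * (be `^ t * (al `^ (1 - t) * p)) by ring.
  by rewrite ler_wpM2l // ler_wpM2l ?powR_ge0.
have pE : p = p `^ t * p `^ (1 - t).
  by rewrite -powD // addrC subrK powRr1 // ltW.
rewrite {2}pE mulrCA -powRM ?(ltW al0) ?(ltW p0) // ler_peMr ?powR_ge0 //.
have one : 1 `^ (1 - t) = 1 :> R by rewrite powR1.
rewrite -[leLHS]one.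
by rewrite ge0_ler_powR ?nnegrE ?subr_ge0 // mulr_ge0 // ltW.
Qed.

End SpectralMean.
End OperatorPowers.

(** * From the operator order to the inequality *)

(** Positivity in [R[i]] makes the form of [A] real, hence [A] symmetric by polarization. *)
Lemma op_le_selfadjoint (R : realType) (H : completeNormedModType R[i])
    (ip : {dot H for @Num.conj R[i]}) (A : H -> H) (a b : R) :
  positive_definite ip A -> op_le ip (scalar_op a) A ->
  op_le ip A (scalar_op b) -> selfadjoint_in ip A a b.
Proof.
move=> [[lA _] A0 _] aA Ab; split=> // [|x].
  by apply: real_form_symmetric => // x; exact/ger0_real/A0.
have := aA x; have := Ab x; rewrite /scalar_op !lecE => /andP[_ +] /andP[_ +].
by rewrite !ripE !subr_ge0 => -> ->.
Qed.

Theorem theorem2p1 (R : realType) (H : completeNormedModType R[i])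
    (ip : {dot H for @Num.conj R[i]}) (hip : inner_product_of ip)
    (m M : R) (hm : 0 < m) (hmM : m <= M)
    (A B : H -> H)
    (hA : positive_definite ip A) (hB : positive_definite ip B)
    (hmA : op_le ip (scalar_op m) A) (hAM : op_le ip A (scalar_op M))
    (hmB : op_le ip (scalar_op m) B) (hBM : op_le ip B (scalar_op M))
    (t : R) (ht0 : 0 <= t) (ht1 : t <= 1)
    (x : H) (hx : `|x| = 1) :
  ip (spectral_geometric_mean t A B x) x <=
    ((M `^ (1 + t) + m `^ (1 + t)) ^+ 2 / (4 * M `^ (1 + t) * m `^ (1 + t))
      * complex.Re (ip (A x) x) `^ (1 - t)
      * complex.Re (ip (B x) x) `^ t)%:C.
Proof.
have sA := op_le_selfadjoint hA hmA hAM; have sB := op_le_selfadjoint hB hmB hBM.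
have x1 : complex.Re (ip x x) = 1 by rewrite -hip hx expr1n.
have M0 := lt_le_trans hm hmM.
have g0 : 0 < Num.sqrt (m / M) by rewrite sqrtr_gt0 divr_gt0.
have sG := geometric_mean_selfadjoint hip hm hmM sA sB.
have symT := op_pow_symmetric hip g0 sG t.
(* Moving the outer power across [ip] leaves the form of [A] at [op_pow G t x], a real number. *)
rewrite /spectral_geometric_mean /= symT; have [_ A0 _] := hA.
rewrite -(RRe_real (ger0_real (A0 _))) lecR.
by apply: spectral_mean_rip_le; rewrite ?ht0.
Qed.
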